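(* Let $p$ be a prime and $d\in\mathbb{N}$. Let $\mathcal{P}$ be one of the following multisets in $[0,1)^d$: (i) $\mathcal{P}_p^{\rm Kor}=\{\boldsymbol{x}_0,\ldots,\boldsymbol{x}_{p-1}\}$ with $\boldsymbol{x}_n=(\{n/p\},\{n^2/p\},\ldots,\{n^d/p\})$, $N=p$; (ii) $\mathcal{Q}_{p^2}^{\rm Kor}=\{\boldsymbol{x}_0,\ldots,\boldsymbol{x}_{p^2-1}\}$ with $\boldsymbol{x}_n=(\{n/p^2\},\{n^2/p^2\},\ldots,\{n^d/p^2\})$, $N=p^2$; (iii) $\mathcal{R}_{p^2}^{\rm Kor}=\{\boldsymbol{x}_{a,k}: a,k\in\{0,\ldots,p-1\}\}$ with $\boldsymbol{x}_{a,k}=(\{k/p\},\{ak/p\},\ldots,\{a^{d-1}k/p\})$, $N=p^2$. Then, with $N$ the number of points of $\mathcal{P}$ (counted with multiplicity), $$L_{2,N}^{\rm per}(\mathcal{P})\le \frac{d}{2^{d/2}}\frac{1}{\sqrt{N}}.$$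
   Context: $\{x\}=x-\lfloor x\rfloor$ denotes the fractional part. For $x,y\in[0,1)$ define $I(x,y)=[x,y)$ if $x\le y$ and $I(x,y)=[0,y)\cup[x,1)$ if $x>y$; for $\boldsymbol{x},\boldsymbol{y}\in[0,1)^d$ let $B(\boldsymbol{x},\boldsymbol{y})=I(x_1,y_1)\times\cdots\times I(x_d,y_d)$. For an $N$-point (multi)set $\mathcal{P}=\{\boldsymbol{x}_1,\ldots,\boldsymbol{x}_N\}$, the local discrepancy is $\Delta_{\mathcal{P}}(B)=\#\{j:\boldsymbol{x}_j\in B\}/N-\mathrm{volume}(B)$ (points counted with multiplicity), and the periodic $L_2$-discrepancy is $L_{2,N}^{\rm per}(\mathcal{P})=\big(\int_{[0,1]^d}\int_{[0,1]^d}\Delta_{\mathcal{P}}(B(\boldsymbol{x},\boldsymbol{y}))^2\,{\rm d}\boldsymbol{x}\,{\rm d}\boldsymbol{y}\big)^{1/2}$. *)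

(* Defs.v *)
From HB Require Import structures.
From mathcomp Require Import all_boot all_order all_algebra.
From mathcomp Require Import all_classical all_reals all_analysis.
Set Implicit Arguments. Unset Strict Implicit. Unset Printing Implicit Defensive.
Import Order.TTheory GRing.Theory Num.Theory.
Local Open Scope ring_scope.

Section Discrepancy.
Variable R : realType.

Definition frac (x : R) : R := x - (Num.floor x)%:~R.

Definition inI (x y t : R) : bool :=
  if x <= y then (x <= t) && (t < y) else (t < y) || (x <= t).

(* length (Lebesgue measure) of I(x,y) for x,y in [0,1) *)
Definition lenI (x y : R) : R := if x <= y then y - x else 1 - x + y.

(* points and box corners are coordinate functions nat -> R; only the
   coordinates 0..d-1 matter. *)
Definition inB (d : nat) (x y z : nat -> R) : bool :=
  [forall i : 'I_d, inI (x i) (y i) (z i)].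

Definition volB (d : nat) (x y : nat -> R) : R :=
  \prod_(i < d) lenI (x i) (y i).

Definition local_disc (d N : nat) (X : nat -> nat -> R) (x y : nat -> R) : R :=
  (\sum_(n < N) (inB d x y (X n))%:R) / N%:R - volB d x y.

(* iterated Lebesgue integral over [0,1]^n of a nonnegative function of
   the list of the n variables (Tonelli: equals the integral w.r.t. the
   n-dimensional Lebesgue measure for nonnegative measurable integrands). *)
Fixpoint iint (n : nat) (f : seq R -> \bar R) : \bar R :=
  match n with
  | 0 => f [::]
  | n'.+1 => (\int[lebesgue_measure]_(t in `[0%R, 1%R]) iint n' (fun s => f (t :: s)))%E
  end.

Definition L2per_sq (d N : nat) (X : nat -> nat -> R) : \bar R :=
  iint (d + d) (fun s =>
    ((local_disc d N X (fun i => nth 0 s i) (fun i => nth 0 s (d + i))) ^+ 2)%:E).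

Definition PKor (p : nat) (n i : nat) : R := frac ((n ^ i.+1)%:R / p%:R).
Definition QKor (p : nat) (n i : nat) : R := frac ((n ^ i.+1)%:R / (p ^ 2)%:R).
(* (iii) x_{a,k} = ({k/p}, {ak/p}, ..., {a^(d-1)k/p}), a,k = 0..p-1,
   enumerated as n = a*p + k, n = 0..p^2-1 *)
Definition RKor (p : nat) (n i : nat) : R :=
  frac (((n %/ p) ^ i * (n %% p))%:R / p%:R).

End Discrepancy.

(* Main.v *)
(** With kappa(u) = 1/2 - u + u^2, the squared discrepancy of the points x_n is
    N^-2 sum_{n,m} prod_i kappa(|x_{n,i} - x_{m,i}|) - 3^-d.  On multiples of 1/M
    the kernel has the expansion kappa(|a - b|/M) = sum_k c_k e(k(a - b)/M) with
    c_k >= 0, so the double sum equals sum_k (prod_i c_{k_i}) |S(k)|^2, where S(k)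
    are the exponential sums of the point set.  Frequencies k divisible by p
    contribute at most (1/3 + 1/(6p^2))^d N^2 by the trivial bound |S(k)| <= N.
    For the others |S(k)| <= (d-1) sqrt N, while sum_k c_k = 1/2.  If N <= d^2 the
    bound kappa <= 1/2 is already enough, so one may assume d < p.

    For the sets of p^2 points, |S(k)| is p times a sum over the roots of a nonzero
    polynomial modulo p.  For the set of p points it is Weil's bound.  There, the
    sums S_n over the extensions F_{p^n} satisfy n a_n = sum_r S_r a_{n-r}, where
    a_n sums a completely multiplicative weight over monic polynomials of degree n
    and vanishes for n >= d; hence S_n = - sum_j w_j^n for d-1 complex numbers w_j.
    Stepanov's auxiliary polynomial gives S_{2m} = O(p^m), which forces
    |w_j| <= sqrt p, and so |S_1| <= (d-1) sqrt p. *)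

Require Import Defs.
From HB Require Import structures.
From mathcomp Require Import all_boot all_order all_algebra all_solvable all_field.
From mathcomp Require Import all_classical all_reals all_analysis.
From mathcomp Require Import complex.
From mathcomp Require Import ring lra zify.
Set Implicit Arguments. Unset Strict Implicit. Unset Printing Implicit Defensive.
Import Order.TTheory GRing.Theory Num.Theory.
Import numFieldNormedType.Exports.
Local Open Scope ring_scope.

(** * Newton's identities *)

(** The target for the squared discrepancy is d^2 2^-d / N, and it is met as follows. Frequencies
    with an entry prime to p cost (d-1)^2 2^-d / N. The others have one-dimensional mass 1/3 +
    1/(6p^2); after subtraction of 3^-d they leave at most d/(3p^2) 2^-d, which is at most d/(3N)
    2^-d because N <= p^2. Finally d/3 + (d-1)^2 <= d^2. The split is by divisibility by p, and not
    by k = 0, because with denominators p^2 a nonzero k divisible by p vanishes modulo p and the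
    root count says nothing about it. The reduction to d < p makes the exponents up to d invertible
    modulo p. This is what allows the phase modulo p^2 to be differentiated and, in Weil's bound, a
    d-th power sum to be moved by a nonzero amount and the degrees in the auxiliary polynomial to be
    kept apart. *)

Section Newton.
Variable R : comNzRingType.
Implicit Types rs : seq R.

(* The coefficients are the signed elementary symmetric functions of [rs]; unlike
   those of [\prod_(z <- rs) ('X - z%:P)], they do not shift with [size rs]. *)
Definition revprod rs : {poly R} := \prod_(z <- rs) (1 - z *: 'X).

Lemma revprod0 rs : (revprod rs)`_0 = 1.
Proof.
rewrite /revprod; elim: rs => [|z rs IH]; first by rewrite big_nil coef1.
by rewrite big_cons mulrBl mul1r -scalerAl coefB coefZ coefXM IH /= mulr0 subr0.
Qed.

Lemma revprod_consS z rs l :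
  (revprod (z :: rs))`_l.+1 = (revprod rs)`_l.+1 - z * (revprod rs)`_l.
Proof.
by rewrite /revprod big_cons mulrBl mul1r -scalerAl coefB coefZ coefXM.
Qed.

Lemma newton rs l :
  \sum_(j < l) (revprod rs)`_j * (\sum_(z <- rs) z ^+ (l - j)) =
  - l%:R * (revprod rs)`_l.
Proof.
elim: rs l => [|z rs IH] l.
  rewrite [RHS](_ : _ = 0); last first.
    by rewrite /revprod big_nil coef1; case: l => [|l]; rewrite ?oppr0 ?mul0r ?mulr0.
  by rewrite big1 // => j _; rewrite big_nil mulr0.
case: l => [|l]; first by rewrite big_ord0 oppr0 mul0r.
under eq_bigr do rewrite big_cons mulrDr.
rewrite big_split /=.
(* Dividing [revprod (z :: rs)] by 1 - zX gives back [revprod rs]; this is z times the coefficient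
   of index l of that quotient. *)
have -> : \sum_(j < l.+1) (revprod (z :: rs))`_j * z ^+ (l.+1 - j) =
          z * (revprod rs)`_l.
  elim: l => [|l IHl].
    by rewrite big_ord_recl big_ord0 /= !revprod0 subn0 mul1r mulr1 addr0.
  rewrite big_ord_recr /=.
  rewrite (eq_bigr (fun i : 'I_l.+1 =>
      z * ((revprod (z :: rs))`_i * z ^+ (l.+1 - i)))); last first.
    by move=> i _; rewrite subSn 1?ltnW // exprS mulrCA.
  rewrite -mulr_sumr IHl revprod_consS subSnn expr1; ring.
have -> : \sum_(j < l.+1) (revprod (z :: rs))`_j *
    (\sum_(w <- rs) w ^+ (l.+1 - j)) =
  \sum_(j < l.+1) (revprod rs)`_j * (\sum_(w <- rs) w ^+ (l.+1 - j))
   - z * \sum_(j < l) (revprod rs)`_j * (\sum_(w <- rs) w ^+ (l - j)).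
  rewrite big_ord_recl [in X in _ = X - _]big_ord_recl !revprod0.
  rewrite -addrA; congr (_ + _); rewrite mulr_sumr -sumrB; apply: eq_bigr => i _.
  by rewrite /bump /= revprod_consS subSS mulrBl mulrA.
rewrite !IH revprod_consS -[l.+1]addn1 natrD addn1; ring.
Qed.

Lemma size_revprod rs : (size (revprod rs) <= (size rs).+1)%N.
Proof.
rewrite /revprod; elim: rs => [|w rs IHr]; first by rewrite big_nil size_poly1.
rewrite big_cons (leq_trans (size_polyMleq _ _)) //.
have: (size (1 - w *: 'X : {poly R})%R <= 2)%N.
  rewrite (leq_trans (size_polyD _ _)) // geq_max size_poly1 size_polyN.
  by rewrite (leq_trans (size_scale_leq _ _)) ?size_polyX.
by move=> le2; rewrite -subn1 leq_subLR (leq_trans (leq_add le2 IHr)).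
Qed.

Lemma coef_prod_XsubC rs j : (j <= size rs)%N ->
  (\prod_(z <- rs) ('X - z%:P))`_(size rs - j) = (revprod rs)`_j.
Proof.
elim: rs j => [|z rs IH] j.
  by rewrite leqn0 => /eqP ->; rewrite /revprod !big_nil.
case: j => [_|j].
  rewrite revprod0 subn0.
  have /monicP := monic_prod_XsubC (z :: rs) predT id.
  by rewrite /lead_coef size_prod_XsubC.
rewrite /= ltnS subSS => lej; rewrite revprod_consS big_cons mulrBl coefB coefXM coefCM.
rewrite IH //; case: eqP => [/eqP e|/eqP e].
  have {e} e : j = size rs by apply/eqP; rewrite eqn_leq lej -subn_eq0.
  rewrite e; congr (_ - _).
  by rewrite nth_default // size_revprod.
rewrite -(IH j.+1); last by lia.
by rewrite subnS.
Qed.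

(** In Newton's identity the l-th power sum has coefficient 1, so it is recovered from the
    coefficients up to l without dividing by l. The argument is thus valid in characteristic p. *)
Lemma psum_eq (rs rs' : seq R) d :
    (forall j, (j < d)%N -> (revprod rs)`_j = (revprod rs')`_j) ->
  forall l, (0 < l < d)%N -> \sum_(z <- rs) z ^+ l = \sum_(z <- rs') z ^+ l.
Proof.
move=> eqc; elim/ltn_ind => -[//|l] IH /= ltl.
have := newton rs l.+1; have := newton rs' l.+1.
rewrite -(eqc l.+1) // => <-.
rewrite !big_ord_recl !revprod0 !mul1r !subn0 => /eqP.
rewrite (eq_bigr (fun i : 'I_l => (revprod rs')`_(lift ord0 i) *
   (\sum_(z <- rs') z ^+ (l.+1 - lift ord0 i)))); last first.
  move=> i _; rewrite eqc; last by rewrite lift0; have := ltn_ord i; lia.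
  by rewrite IH //; rewrite lift0; have := ltn_ord i; lia.
by move=> /eqP/addIr.
Qed.

Lemma psum_diff (rs rs' : seq R) d : (0 < d)%N ->
    (forall j, (j < d)%N -> (revprod rs)`_j = (revprod rs')`_j) ->
  \sum_(z <- rs) z ^+ d - \sum_(z <- rs') z ^+ d =
  - d%:R * ((revprod rs)`_d - (revprod rs')`_d).
Proof.
case: d => [//|d] _ eqc; rewrite mulrBr -!newton !big_ord_recl !revprod0 !mul1r !subn0.
rewrite (eq_bigr (fun i : 'I_d => (revprod rs')`_(lift ord0 i) *
   (\sum_(z <- rs') z ^+ (d.+1 - lift ord0 i)))); first by ring.
move=> i _; have lti := ltn_ord i; rewrite eqc; last by rewrite lift0; lia.
by rewrite (psum_eq eqc) //; rewrite lift0; lia.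
Qed.

End Newton.

(** * Frobenius orbits in an algebraic closure of the prime field *)

Lemma sum_nat_bool (T : Type) (P : pred T) (s : seq T) :
  (\sum_(x <- s) P x = size [seq x <- s | P x])%N.
Proof.
by rewrite size_filter -sum1_count [RHS]big_mkcond; apply: eq_bigr => x _; case: (P x).
Qed.

Section Closure.
Variables (p : nat) (p_pr : prime p) (Om : closedFieldType).
Variable emb : {rmorphism 'F_p -> Om}.

Let pchOm : p \in [pchar Om].
Proof. exact: (rmorph_pchar emb (pchar_Fp p_pr)). Qed.

Lemma frobD i (x y : Om) : (x + y) ^+ (p ^ i) = x ^+ (p ^ i) + y ^+ (p ^ i).
Proof. by rewrite exprDn_pchar // pnatX pnatE // pchOm. Qed.

Lemma frob_inj i : injective (fun x : Om => x ^+ (p ^ i)).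
Proof.
move=> x y /= e; apply/eqP; rewrite -subr_eq0; apply/eqP.
have := frobD i (x - y) y; rewrite subrK e => /eqP.
rewrite -subr_eq subrr eq_sym => /eqP/eqP; rewrite expf_eq0 => /andP[_ /eqP].
by [].
Qed.

Lemma Fp_frob i (a : 'F_p) : a ^+ (p ^ i) = a.
Proof.
elim: i => [|i IH]; first by rewrite expn0 expr1.
by rewrite expnSr exprM IH -[X in _ ^+ X](card_Fp p_pr) expf_card.
Qed.

Lemma Fp_exp (a : 'F_p) : a ^+ p = a.
Proof. by have := Fp_frob 1 a; rewrite expn1. Qed.

Lemma horner_frob (g : {poly 'F_p}) (x : Om) i :
  (map_poly emb g).[x] ^+ (p ^ i) = (map_poly emb g).[x ^+ (p ^ i)].
Proof.
elim/poly_ind: g => [|g c IH].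
  by rewrite rmorph0 !horner0 expr0n expn_eq0 -leqn0 leqNgt prime_gt0.
rewrite rmorphD rmorphM /= map_polyX map_polyC /= !hornerE frobD exprMn IH.
by rewrite -rmorphXn /= Fp_frob.
Qed.

Lemma fixed_emb (x : Om) : x ^+ p = x -> exists a, emb a = x.
Proof.
move=> xp.
have := congr1 (fun q => (map_poly emb q).[x]) (finField_genPoly 'F_p).
rewrite card_Fp // rmorphB /= map_polyXn map_polyX !hornerE xp subrr.
rewrite rmorph_prod horner_prod => /esym/eqP/prodf_eq0[a _].
rewrite rmorphB /= map_polyX map_polyC !hornerE subr_eq0 => /eqP ->.
by exists a.
Qed.

(* Inverse of [emb] on its image, and [0] outside. *)
Definition Fp_of (x : Om) : 'F_p := odflt 0 [pick a | emb a == x].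

Lemma Fp_ofK x : x ^+ p = x -> emb (Fp_of x) = x.
Proof.
move=> /fixed_emb[a ax]; rewrite /Fp_of; case: pickP => [b /eqP //|/(_ a)].
by rewrite ax eqxx.
Qed.

Lemma embK a : Fp_of (emb a) = a.
Proof. by apply: (fmorph_inj emb); rewrite Fp_ofK // -rmorphXn /= Fp_exp. Qed.

Lemma poly_descent (g : {poly Om}) :
  map_poly (pFrobenius_aut pchOm) g = g -> exists g0, g = map_poly emb g0.
Proof.
move=> gF; exists (map_poly Fp_of g); apply/polyP => i.
rewrite coef_map /= coef_map_id0 ?Fp_ofK //; last by rewrite -(rmorph0 emb) embK.
by rewrite -[in RHS]gF coef_map /= pFrobenius_autE.
Qed.

Let expp_gt1 r : (0 < r)%N -> (1 < p ^ r)%N.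
Proof.
case: r => // r _; rewrite expnS (leq_trans (prime_gt1 p_pr)) // leq_pmulr //.
by rewrite expn_gt0 prime_gt0.
Qed.

(** For r > 0 this lists the subfield with p^r elements. *)
Definition frob_fixed r : seq Om :=
  sval (closed_field_poly_normal ('X^(p ^ r) - 'X : {poly Om})).

Lemma prod_frob_fixed r : (0 < r)%N ->
  \prod_(z <- frob_fixed r) ('X - z%:P) = 'X^(p ^ r) - 'X :> {poly Om}.
Proof.
move=> r0; rewrite /frob_fixed; case: closed_field_poly_normal => rs /= e.
rewrite e [X in X *: _](_ : _ = 1) ?scale1r //.
rewrite lead_coefDl ?lead_coefXn // size_polyN size_polyX size_polyXn ltnS.
exact: expp_gt1.
Qed.

Lemma mem_frob_fixed r x : (0 < r)%N -> (x \in frob_fixed r) = (x ^+ (p ^ r) == x).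
Proof.
by move=> r0; rewrite -root_prod_XsubC prod_frob_fixed // rootE !hornerE subr_eq0.
Qed.

Lemma size_frob_fixed r : (0 < r)%N -> size (frob_fixed r) = (p ^ r)%N.
Proof.
move=> r0; apply/eqP; rewrite -eqSS -(size_prod_XsubC _ id) prod_frob_fixed //.
rewrite size_polyDl ?size_polyXn // size_polyN size_polyX ltnS.
exact: expp_gt1.
Qed.

Lemma uniq_frob_fixed r : (0 < r)%N -> uniq (frob_fixed r).
Proof.
move=> r0; rewrite -separable_prod_XsubC prod_frob_fixed //.
rewrite unlock derivB derivXn derivX.
have -> : 'X^((p ^ r).-1) *+ (p ^ r) = 0 :> {poly Om}.
  by rewrite -mulr_natr natrX -polyC_natr (pcharf0 pchOm) expr0n -leqn0 leqNgt r0 mulr0.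
by rewrite sub0r -[X in coprimep _ X]scaleN1r coprimepZr ?oppr_eq0 ?oner_neq0 // coprimep1.
Qed.

(** For al in the field with p^r elements, this is the characteristic polynomial of al over the
    prime field; it is reducible when al lies in a proper subfield. *)
Definition conj_poly r (al : Om) : {poly Om} := \prod_(i < r) ('X - (al ^+ (p ^ i))%:P).

Lemma conj_poly_monic r al : conj_poly r al \is monic.
Proof. exact: monic_prod_XsubC. Qed.

Lemma size_conj_poly r al : size (conj_poly r al) = r.+1.
Proof. by rewrite /conj_poly size_prod_XsubC /index_enum -enumT size_enum_ord. Qed.

Lemma conj_poly_Frob r al : al ^+ (p ^ r) = al ->
  map_poly (pFrobenius_aut pchOm) (conj_poly r al) = conj_poly r al.
Proof.
move=> alr; rewrite /conj_poly rmorph_prod /=.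
under eq_bigr do rewrite rmorphB /= map_polyX map_polyC /= pFrobenius_autE -exprM -expnSr.
case: r alr => [|r] alr; first by rewrite !big_ord0.
rewrite big_ord_recr [RHS]big_ord_recl /= alr expn0 expr1 mulrC; congr (_ * _).
Qed.

Lemma root_conj_poly r al : (0 < r)%N -> root (conj_poly r al) al.
Proof.
by case: r => // r _; rewrite /conj_poly big_ord_recl expn0 expr1 rootM root_XsubC eqxx.
Qed.

Lemma dvdp_prod_exp (g : {poly Om}) s (t : seq Om) : uniq t ->
    (forall x, x \in t -> ('X - x%:P) ^+ s %| g) ->
  (\prod_(x <- t) ('X - x%:P)) ^+ s %| g.
Proof.
elim: t => [|x t IH] /=; first by rewrite big_nil expr1n dvd1p.
move=> /andP[xt ut] dv; rewrite big_cons exprMn Gauss_dvdp; last first.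
  apply: coprimep_expl; apply: coprimep_expr.
  by rewrite coprimep_sym coprimep_XsubC root_prod_XsubC.
rewrite dv ?mem_head //=; apply: IH => // y yt; apply: dv.
by rewrite inE yt orbT.
Qed.

Section Count.
Variables (n : nat) (g0 : {poly 'F_p}).
Hypotheses (g0m : g0 \is monic) (sg0 : size g0 = n.+1).
Let g : {poly Om} := map_poly emb g0.
Variable rs : seq Om.
Hypothesis grs : g = \prod_(z <- rs) ('X - z%:P).

Let gn0 : g != 0. Proof. by rewrite grs monic_neq0 ?monic_prod_XsubC. Qed.

Let gF : map_poly (pFrobenius_aut pchOm) g = g.
Proof.
apply/polyP => i; by rewrite /g !coef_map /= pFrobenius_autE -rmorphXn /= Fp_exp.
Qed.

Let dvd_frob x s i : ('X - x%:P) ^+ s %| g -> ('X - (x ^+ (p ^ i))%:P) ^+ s %| g.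
Proof.
elim: i => [|i IH]; first by rewrite expn0 expr1.
move=> /IH; rewrite -(dvdp_map (pFrobenius_aut pchOm)) gF rmorphXn rmorphB /=.
by rewrite map_polyX map_polyC /= pFrobenius_autE -exprM -expnSr.
Qed.

(** Frobenius maps roots of g to roots of g, so the orbit of al stays in a finite list and repeats;
    injectivity of Frobenius pulls the repetition back to al itself. *)
Lemma frob_period al : al \in rs ->
  exists2 m, (0 < m)%N & al ^+ (p ^ m) = al.
Proof.
move=> alrs.
have orb i : al ^+ (p ^ i) \in rs.
  rewrite -root_prod_XsubC -grs root_factor_theorem -(expr1 ('X - _)).
  by rewrite dvd_frob // expr1 -root_factor_theorem grs root_prod_XsubC.
pose h (i : 'I_(size rs).+1) := index (al ^+ (p ^ i)) rs.
have hlt i : (h i < size rs)%N by rewrite index_mem.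
have /injectivePn[i [j ij /(congr1 val) /= hij]] :
    ~~ injectiveb (fun i => Ordinal (hlt i)).
  by apply/injectiveP => /leq_card; rewrite !card_ord ltnn.
have {hij} e : al ^+ (p ^ i) = al ^+ (p ^ j).
  by rewrite -(nth_index 0 (orb i)) -(nth_index 0 (orb j)); congr nth.
have : (i < j)%N || (j < i)%N by rewrite -neq_ltn.
wlog lij : i j ij e / (i < j)%N => [H|_].
  by case/orP => l; [apply: (H i j)|apply: (H j i)]; rewrite // 1?eq_sym ?l.
exists (j - i)%N; first by rewrite subn_gt0.
by apply: (@frob_inj i); rewrite -exprM -expnD subnK // ltnW.
Qed.

(* If [al] has period [m] under Frobenius, then [conj_poly (s * m) al] is the
   [s]-th power of its minimal polynomial over the prime field, so it divides [g]
   iff [s] is at most the multiplicity of [al]. *)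
Lemma count_conj_poly_root al : al \in rs ->
  (\sum_(1 <= r < n.+1) ((al ^+ (p ^ r) == al) && (conj_poly r al %| g))%R =
   count_mem al rs)%N.
Proof.
move=> alrs; have [m0 m0_gt0 m0P] := frob_period alrs.
have exm : exists m, (0 < m)%N && (al ^+ (p ^ m) == al).
  by exists m0; rewrite m0_gt0 m0P eqxx.
case: (ex_minnP exm) => m /andP[m_gt0 /eqP mP] mmin.
have mulP s : al ^+ (p ^ (s * m)) = al.
  by elim: s => [|s IH]; rewrite ?expr1 // mulSn expnD exprM mP.
have perP r : (al ^+ (p ^ r) == al) = (m %| r)%N.
  rewrite {1}(divn_eq r m) expnD exprM mulP /dvdn.
  apply/idP/eqP => [e|->]; last by rewrite expr1.
  apply/eqP; apply: contraTT isT => nz.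
  by have := mmin (r %% m)%N; rewrite lt0n nz e leqNgt ltn_mod m_gt0 => /(_ isT).
have conj_polyX s : conj_poly (s * m) al = conj_poly m al ^+ s.
  elim: s => [|s IH]; first by rewrite /conj_poly big_ord0.
  rewrite exprS -IH /conj_poly -!(big_mkord xpredT (fun i => 'X - (al ^+ (p ^ i))%:P)).
  rewrite mulSn (@big_cat_nat _ _ _ m) ?leq_addr //=; congr (_ * _).
  rewrite -{1}[m]add0n big_addn addKn; apply: eq_bigr => i _.
  by rewrite addnC expnD exprM mP.
have mup_al : mup al g = count_mem al rs by rewrite grs mu_prod_XsubC.
have orb_uniq : uniq [seq al ^+ (p ^ i) | i <- iota 0 m].
  rewrite map_inj_in_uniq ?iota_uniq // => i j; rewrite !mem_iota /= !add0n.
  wlog lij : i j / (i <= j)%N => [H im jm e|im jm e].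
    by case/orP: (leq_total i j) => l; [apply: H|apply/esym/H].
  have : al ^+ (p ^ (j - i)) = al.
    by apply: (@frob_inj i); rewrite -exprM -expnD subnK.
  move/eqP; rewrite perP => /dvdnP[[|k]]; first by lia.
  by rewrite mulSn => ?; lia.
have dvdE s : (conj_poly (s * m) al %| g) = (s <= count_mem al rs)%N.
  rewrite conj_polyX -mup_al mup_geq //; apply/idP/idP => [|dv].
    apply: dvdp_trans; apply: dvdp_exp2r.
    by rewrite -root_factor_theorem root_conj_poly.
  have -> : conj_poly m al = \prod_(x <- [seq al ^+ (p ^ i) | i <- iota 0 m]) ('X - x%:P).
    by rewrite big_map /conj_poly -(big_mkord xpredT (fun i => 'X - (al ^+ (p ^ i))%:P))
       /index_iota subn0.
  by apply: dvdp_prod_exp => // x /mapP[i _ ->]; apply: dvd_frob.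
set e := count_mem al rs in dvdE *.
have em : (e * m <= n)%N.
  have : conj_poly (e * m) al %| g by rewrite dvdE.
  by move/(dvdp_leq gn0); rewrite size_conj_poly /g size_map_poly sg0 ltnS.
rewrite (eq_bigr (fun r => nat_of_bool ((m %| r) && (r %/ m <= e))%N)); last first.
  move=> r _; rewrite perP; case: (boolP (m %| r)%N) => // /dvdnP[s ->].
  by rewrite dvdE mulnK.
rewrite sum_nat_bool.
rewrite -[RHS](size_iota 1) -[RHS](size_map (muln^~ m)); apply: perm_size.
apply: uniq_perm; first by rewrite filter_uniq // iota_uniq.
  rewrite map_inj_uniq ?iota_uniq // => i j /eqP.
  by rewrite eqn_pmul2r // => /eqP.
move=> r; rewrite mem_filter mem_index_iota; apply/idP/mapP.
  move=> /andP[/andP[/dvdnP[s ->]]]; rewrite mulnK // => se /andP[r1 _].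
  by exists s => //; rewrite mem_iota add1n ltnS se andbT; case: s r1 {se}.
move=> [s]; rewrite mem_iota add1n ltnS => /andP[s1 se] ->.
rewrite dvdn_mull // mulnK // se /= muln_gt0 s1 m_gt0 ltnS.
by rewrite (leq_trans _ em) // leq_mul2r se orbT.
Qed.

(** After the summations are exchanged, each distinct root of g contributes its multiplicity, and
    the multiplicities add up to the degree. *)
Lemma sum_count_conj_poly :
  (\sum_(1 <= r < n.+1) count (fun al => (conj_poly r al %| g)%R) (frob_fixed r) = n)%N.
Proof.
have srs : size rs = n.
  by apply/eqP; rewrite -eqSS -(size_prod_XsubC _ id) -grs /g size_map_poly sg0.
rewrite -[RHS]srs -sum1_size -[RHS]big_undup_iterop_count /=.
transitivity (\sum_(al <- undup rs) \sum_(1 <= r < n.+1)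
   ((al ^+ (p ^ r) == al) && (conj_poly r al %| g))%R)%N; last first.
  apply: eq_big_seq => al; rewrite mem_undup => /count_conj_poly_root ->.
  by case: (count_mem _ _) => // k; rewrite /iterop iteriS; elim: k => //= k <-.
rewrite exchange_big /=; apply: eq_big_nat => r /andP[r1 _].
rewrite sum_nat_bool -size_filter; apply: perm_size; apply: uniq_perm.
- by rewrite filter_uniq // uniq_frob_fixed.
- by rewrite filter_uniq // undup_uniq.
move=> al; rewrite !mem_filter mem_frob_fixed // mem_undup.
case: (boolP (conj_poly r al %| g)) => dv; last by rewrite andbF.
rewrite andbT; case: eqP => //= _; apply/esym.
by rewrite -root_prod_XsubC -grs; apply: root_dvdp dv _; apply: root_conj_poly.
Qed.

End Count.
End Closure.

(** * The L-function of an additive character sum *)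

Section Monics.
Variable F : finFieldType.

Definition monics k : seq {poly F} := [seq 'X^k + rVpoly v | v : 'rV[F]_k].

Lemma mem_monics k g : (g \in monics k) = (g \is monic) && (size g == k.+1).
Proof.
have szv (v : 'rV[F]_k) : (size (rVpoly v) < size ('X^k : {poly F})%R)%N.
  by rewrite size_polyXn ltnS size_poly.
apply/mapP/andP => [[v _ ->]|[gm /eqP sg]].
  rewrite size_polyDl // size_polyXn; split=> //.
  by apply/monicP; rewrite lead_coefDl // lead_coefXn.
exists (poly_rV (g - 'X^k)); first by rewrite mem_enum.
rewrite poly_rV_K; first by rewrite addrC subrK.
apply/leq_sizeP => j.
rewrite leq_eqVlt coefB coefXn => /orP[/eqP <-|ltj].
  by move/monicP: gm; rewrite /lead_coef sg /= => ->; rewrite eqxx subrr.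
by rewrite gtn_eqF // subr0 nth_default // sg.
Qed.

Lemma uniq_monics k : uniq (monics k).
Proof.
rewrite map_inj_uniq ?enum_uniq // => u v /addrI.
exact: (can_inj (@rVpolyK _ _)).
Qed.

Lemma monics_dvd k r (c : {poly F}) : c \is monic -> size c = r.+1 -> (r <= k)%N ->
  perm_eq [seq g <- monics k | c %| g] [seq c * h | h <- monics (k - r)].
Proof.
move=> cm sc ler; apply: uniq_perm.
- by rewrite filter_uniq // uniq_monics.
- rewrite map_inj_uniq ?uniq_monics //; exact: (mulfI (monic_neq0 cm)).
move=> g; rewrite mem_filter mem_monics; apply/idP/mapP.
  move=> /and3P[/dvdpP[h ->] ghm sgh]; exists h; last by rewrite mulrC.
  have hm : h \is monic by rewrite monicMr in ghm.
  rewrite mem_monics hm /=; move: sgh.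
  by rewrite size_Mmonic ?monic_neq0 // sc addnS /=; lia.
move=> [h]; rewrite mem_monics => /andP[hm /eqP sh] ->.
rewrite dvdp_mulIl monicMl // hm size_Mmonic ?monic_neq0 // sc sh /=.
by apply/eqP; lia.
Qed.

Lemma monics_shift k j : (j < k)%N ->
  perm_eq [seq g + 'X^j | g <- monics k] (monics k).
Proof.
move=> ltj; apply: uniq_perm.
- by rewrite map_inj_uniq ?uniq_monics //; apply: addIr.
- exact: uniq_monics.
have sX (g : {poly F}) : size g = k.+1 -> (size ('X^j : {poly F})%R < size g)%N.
  by move=> ->; rewrite size_polyXn ltnS.
move=> g; apply/mapP/idP => [[h]|]; rewrite !mem_monics => /andP[hm /eqP sh].
  move=> ->; rewrite size_polyDl ?sX // sh eqxx andbT.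
  by rewrite monicE lead_coefDl ?sX.
exists (g - 'X^j); last by rewrite subrK.
by rewrite mem_monics monicE lead_coefDl ?size_polyDl ?size_polyN ?sX // -monicE hm sh eqxx.
Qed.

End Monics.

Section LFunction.
Variables (p : nat) (p_pr : prime p) (Om : closedFieldType).
Variable emb : {rmorphism 'F_p -> Om}.
Variables (C : idomainType) (psi : 'F_p -> C).
Hypothesis psiD : forall a b, psi (a + b) = psi a * psi b.
Hypothesis psi0 : psi 0 = 1.
Variable f : {poly 'F_p}.
Let fO := map_poly emb f.
Notation frob_fixed := (@frob_fixed p Om).
Notation Fp_of := (Fp_of emb).
Notation pchOm := (rmorph_pchar emb (pchar_Fp p_pr)).

Definition root_weight (rs : seq Om) : C := psi (Fp_of (\sum_(z <- rs) fO.[z])).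

Definition closed_roots (g : {poly Om}) : seq Om := sval (closed_field_poly_normal g).

Lemma closed_rootsE g : g \is monic -> g = \prod_(z <- closed_roots g) ('X - z%:P).
Proof.
by rewrite /closed_roots; case: closed_field_poly_normal => rs /= e /monicP lg;
   rewrite {1}e lg scale1r.
Qed.

Definition weight (g : {poly 'F_p}) := root_weight (closed_roots (map_poly emb g)).

Lemma weightE g rs : map_poly emb g = \prod_(z <- rs) ('X - z%:P) -> weight g = root_weight rs.
Proof.
move=> e; rewrite /weight /root_weight; congr (psi (Fp_of _)); apply: perm_big.
apply: prod_XsubC_eq; rewrite -closed_rootsE //.
by rewrite e monic_prod_XsubC.
Qed.

(** Frobenius permutes the roots of a polynomial over the prime field. The sum is therefore in the
    image of [emb], and [Fp_of] does not return its default value on it. *)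
Lemma frob_roots_sum g rs : map_poly emb g = \prod_(z <- rs) ('X - z%:P) ->
  (\sum_(z <- rs) fO.[z]) ^+ p = \sum_(z <- rs) fO.[z].
Proof.
move=> e; rewrite -(pFrobenius_autE pchOm) rmorph_sum /=.
rewrite (eq_bigr (fun z => fO.[z ^+ p])) => [|z _]; last first.
  by rewrite pFrobenius_autE -[p in LHS]expn1 horner_frob.
rewrite -(big_map (fun z => z ^+ p) xpredT (fun z => fO.[z])).
apply: perm_big; apply: prod_XsubC_eq; rewrite -e big_map.
transitivity (map_poly (pFrobenius_aut pchOm) (map_poly emb g)).
  rewrite e rmorph_prod /=; apply: eq_bigr => z _.
  by rewrite rmorphB /= map_polyX map_polyC /= pFrobenius_autE.
apply/polyP => i; rewrite !coef_map /= pFrobenius_autE -rmorphXn /=.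
by rewrite Fp_exp.
Qed.

Lemma Fp_ofD x y : x ^+ p = x -> y ^+ p = y -> Fp_of (x + y) = Fp_of x + Fp_of y.
Proof.
move=> ex ey; apply: (fmorph_inj emb); rewrite rmorphD /= !Fp_ofK //.
by rewrite -[p]expn1 frobD // expn1 ex ey.
Qed.

Lemma weightM g h : g \is monic -> h \is monic -> weight (g * h) = weight g * weight h.
Proof.
move=> gm hm.
have ge := closed_rootsE (monic_map emb gm); have he := closed_rootsE (monic_map emb hm).
rewrite (@weightE (g * h) (closed_roots (map_poly emb g) ++ closed_roots (map_poly emb h))).
  by rewrite /weight /root_weight -psiD -Fp_ofD ?big_cat ?(frob_roots_sum ge) ?(frob_roots_sum he).
by rewrite rmorphM /= big_cat /= -ge -he.
Qed.

Definition weight_sum k : C := \sum_(g <- monics 'F_p k) weight g.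

(** The inner sum is the trace of f(al) from the field with p^r elements to the prime field, so this
    is the character sum lifted to that extension. *)
Definition ext_sum r : C :=
  \sum_(al <- frob_fixed r) psi (Fp_of (\sum_(i < r) fO.[al] ^+ (p ^ i))).

Lemma weight_sum0 : weight_sum 0 = 1.
Proof.
rewrite /weight_sum (perm_big [:: 1]); last first.
  apply: uniq_perm; rewrite ?uniq_monics // => g.
  rewrite mem_monics inE; apply/andP/eqP => [[gm]|->]; last by rewrite monic1 size_poly1.
  by move/size_poly1P => [c c0 gc]; move: gm; rewrite gc monicE lead_coefC => /eqP ->.
rewrite big_seq1 (@weightE _ [::]) ?big_nil ?rmorph1 // /root_weight big_nil.
by rewrite -(rmorph0 emb) embK.
Qed.

(* The logarithmic derivative of the Euler product: by [sum_count_conj_poly] each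
   monic [g] of degree [n] splits off a factor [conj_poly r al] in [n] ways. *)
Lemma weight_sum_rec n :
  n%:R * weight_sum n = \sum_(1 <= r < n.+1) ext_sum r * weight_sum (n - r).
Proof.
rewrite /weight_sum mulr_sumr big_seq_cond.
transitivity (\sum_(g <- monics 'F_p n) \sum_(1 <= r < n.+1)
   \sum_(al <- frob_fixed r) if conj_poly p r al %| map_poly emb g then weight g else 0).
  rewrite [RHS]big_seq_cond; apply: eq_bigr => g /andP[].
  rewrite mem_monics => /andP[gm /eqP sg] _.
  rewrite -{1}(sum_count_conj_poly p_pr gm sg (closed_rootsE (monic_map emb gm))).
  rewrite natr_sum mulr_suml; apply: eq_bigr => r _.
  by rewrite -big_mkcond /= big_const_seq iter_addr_0 mulr_natl.
rewrite exchange_big /=; apply: eq_big_nat => r /andP[r1 rn].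
rewrite exchange_big /= /ext_sum mulr_suml big_seq_cond [RHS]big_seq_cond.
apply: eq_bigr => al /andP[]; rewrite mem_frob_fixed // => /eqP alr _.
have [c cE] := poly_descent (conj_poly_Frob p_pr emb alr).
have cm : c \is monic by rewrite -(map_monic emb) -cE conj_poly_monic.
have sc : size c = r.+1 by rewrite -(size_map_poly emb) -cE size_conj_poly.
rewrite -big_mkcond /=.
under eq_bigl do rewrite cE dvdp_map.
rewrite -big_filter (perm_big _ (monics_dvd cm sc rn)) big_map mulr_sumr.
rewrite big_seq_cond [RHS]big_seq_cond; apply: eq_bigr => h /andP[].
rewrite mem_monics => /andP[hm _] _; rewrite weightM //; congr (_ * _).
(* The roots of [c], with repetition, are the conjugates of al, so its weight is psi of the trace of
   f(al), the summand of [ext_sum]. *)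
rewrite (@weightE _ [seq al ^+ (p ^ i) | i <- index_iota 0 r]); last first.
  by rewrite -cE big_map /conj_poly big_mkord.
rewrite /root_weight big_map big_mkord; congr (psi (Fp_of _)); apply: eq_bigr => i _.
by rewrite /fO horner_frob.
Qed.

Section Vanish.
Variable d : nat.
Hypotheses (d0 : (0 < d)%N) (dp : (d < p)%N) (sf : size f = d.+1).
Hypothesis psi_neq1 : forall a, a != 0 -> psi a != 1.

(* Adding ['X^(k - d)] to a monic polynomial of degree [k] fixes the power sums of
   its roots of exponent below [d] and shifts the [d]-th one by [- d]. *)
Lemma weight_sum_eq0 k : (d <= k)%N -> weight_sum k = 0.
Proof.
(* [b] is the change of the sum of f over the roots: the leading coefficient of f times the shift -
   d. It is nonzero since d < p, so psi b != 1, and a sum multiplied by psi b under a permutation of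
   its terms must vanish. *)
move=> dk; pose b : 'F_p := - d%:R * f`_d.
have b0 : b != 0.
  rewrite mulf_neq0 // ?oppr_eq0; last first.
    by move: (lead_coef_eq0 f); rewrite lead_coefE sf /= -size_poly_eq0 sf => ->.
  by rewrite -(dvdn_pcharf (pchar_Fp p_pr)) gtnNdvd.
suff e : weight_sum k = psi b * weight_sum k.
  apply/eqP; move/eqP: e; rewrite -subr_eq0 -{1}[weight_sum k]mul1r -mulrBl mulf_eq0.
  by rewrite subr_eq0 eq_sym (negPf (psi_neq1 b0)).
have ltkd : (k - d < k)%N by lia.
rewrite /weight_sum -{1}(perm_big _ (monics_shift 'F_p ltkd)) big_map mulr_sumr.
rewrite big_seq_cond [RHS]big_seq_cond; apply: eq_bigr => g /andP[].
rewrite mem_monics => /andP[gm /eqP sg] _.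
have hm : g + 'X^(k - d) \in monics 'F_p k.
  rewrite -(perm_mem (monics_shift 'F_p ltkd)); apply: map_f.
  by rewrite mem_monics gm sg eqxx.
move: hm; set h := g + _; rewrite mem_monics => /andP[hm /eqP sh].
have ge := closed_rootsE (monic_map emb gm); have he := closed_rootsE (monic_map emb hm).
rewrite /weight /root_weight -psiD; congr psi.
have bfix : emb b ^+ p = emb b by rewrite -rmorphXn /= Fp_exp.
rewrite -[b](embK p_pr emb) -Fp_ofD //; last exact: frob_roots_sum ge.
congr Fp_of.
set rs := closed_roots _; set rs' := closed_roots _.
have srs : size rs = k.
  by apply/eqP; rewrite -eqSS -(size_prod_XsubC _ id) -he size_map_poly sh.
have srs' : size rs' = k.
  by apply/eqP; rewrite -eqSS -(size_prod_XsubC _ id) -ge size_map_poly sg.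
have cf j : (j <= k)%N ->
    (revprod rs)`_j = (revprod rs')`_j + (j == d)%:R.
  move=> lej; rewrite -!coef_prod_XsubC ?srs ?srs' // -he -ge !coef_map /=.
  rewrite coefD rmorphD coefXn rmorph_nat; congr (_ + _%:R).
  by apply/eqP/eqP; lia.
have cfd j : (j < d)%N -> (revprod rs)`_j = (revprod rs')`_j.
  by move=> lj; rewrite cf ?ltn_eqF ?addr0 // (leq_trans (ltnW lj)).
have pd : \sum_(z <- rs) z ^+ d = - d%:R + \sum_(z <- rs') z ^+ d.
  apply/eqP; rewrite -subr_eq (psum_diff d0 cfd) cf // eqxx.
  by rewrite addrAC subrr add0r mulr1.
have pj (j : nat) : (j < d)%N -> \sum_(z <- rs) z ^+ j = \sum_(z <- rs') z ^+ j.
  case: j => [_|j lj]; last by rewrite (psum_eq cfd).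
  under eq_bigr do rewrite expr0; under [RHS]eq_bigr do rewrite expr0.
  by rewrite !big_const_seq !count_predT srs srs'.
have horn (t : seq Om) : \sum_(z <- t) fO.[z] =
    \sum_(i < d.+1) fO`_i * \sum_(z <- t) z ^+ i.
  under eq_bigr do rewrite horner_coef size_map_poly sf.
  by rewrite exchange_big /=; apply: eq_bigr => i _; rewrite mulr_sumr.
rewrite !horn !big_ord_recr /= pd mulrDr addrCA; congr (_ + (_ + _)).
  by rewrite /b rmorphM rmorphN rmorph_nat /= coef_map mulrC.
by apply: eq_bigr => i _; rewrite pj.
Qed.

End Vanish.
End LFunction.

(** * Stepanov's method *)

Lemma underdetermined_system (K : fieldType) (I J : finType) (E : I -> J -> K) :
  (#|J| < #|I|)%N ->
  exists u : I -> K, (exists i, u i != 0) /\ forall j, \sum_i u i * E i j = 0.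
Proof.
move=> ltJI.
pose Mat : 'M[K]_(#|I|, #|J|) := \matrix_(a, b) E (enum_val a) (enum_val b).
have /rowV0Pn[v /sub_kermxP vM v0] : kermx Mat != 0.
  by rewrite kermx_eq0 /row_free ltn_eqF // (leq_ltn_trans (rank_leq_col _)).
exists (fun i => v 0 (enum_rank i)); split.
  have /rV0Pn[i vi] := v0; exists (enum_val i); by rewrite enum_valK.
move=> j; have /rowP/(_ (enum_rank j)) := vM; rewrite !mxE => e.
rewrite -[RHS]e [RHS](reindex (@enum_rank I)) /=; last first.
  by exists enum_val => i _; rewrite ?enum_rankK ?enum_valK.
by apply: eq_bigr => i _; rewrite mxE !enum_rankK.
Qed.

(** * Degree bounds in the inner variable of a bivariate polynomial *)

Section Bivariate.
Variable K : fieldType.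
Implicit Types P Q : {poly {poly K}}.

(** The inner variable will be specialized to a point, and the outer one is the expansion parameter
    at that point. Bounding the inner degree bounds the number of linear conditions per order of
    vanishing. *)
Definition coef_deg n P := forall l, (size (P`_l)%R <= n.+1)%N.

Lemma coef_deg_le n n' P : (n <= n')%N -> coef_deg n P -> coef_deg n' P.
Proof. by move=> le h l; apply: leq_trans (h l) _. Qed.

Lemma coef_degC n (c : {poly K}) : (size c <= n.+1)%N -> coef_deg n c%:P.
Proof. by move=> h l; rewrite coefC; case: ifP => _ //; rewrite size_poly0. Qed.

Lemma coef_degD n P Q : coef_deg n P -> coef_deg n Q -> coef_deg n (P + Q).
Proof. by move=> hP hQ l; rewrite coefD (leq_trans (size_polyD _ _)) // geq_max hP hQ. Qed.

Lemma coef_degN n P : coef_deg n P -> coef_deg n (- P).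
Proof. by move=> hP l; rewrite coefN size_polyN. Qed.

Lemma coef_deg_sum n (I : Type) (r : seq I) (F : I -> {poly {poly K}}) :
  (forall i, coef_deg n (F i)) -> coef_deg n (\sum_(i <- r) F i).
Proof.
move=> h; elim: r => [|i r IH]; last by rewrite big_cons; apply: coef_degD.
by move=> l; rewrite big_nil coef0 size_poly0.
Qed.

Lemma coef_degM n m P Q : coef_deg n P -> coef_deg m Q -> coef_deg (n + m) (P * Q).
Proof.
move=> hP hQ l; rewrite coefM (leq_trans (size_sum _ _ _)) //.
apply/bigmax_leqP => i _; rewrite (leq_trans (size_polyMleq _ _)) //.
by have := hP i; have := hQ (l - i)%N; move: (size _) (size _) => a b; lia.
Qed.

Lemma coef_degX n P i : coef_deg n P -> coef_deg (n * i) (P ^+ i).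
Proof.
move=> h; elim: i => [|i IH]; first by rewrite muln0 expr0; apply: coef_degC; rewrite size_poly1.
by rewrite exprS mulnS; apply: coef_degM.
Qed.

End Bivariate.

(** * Congruences modulo a power of the variable *)

Section Congruence.
Variable K : fieldType.
Variable M : nat.
Implicit Types P Q : {poly K}.

Definition eqX P Q := 'X^M %| P - Q.

Lemma eqX_refl P : eqX P P. Proof. by rewrite /eqX subrr dvdp0. Qed.

Lemma eqXD P Q P' Q' : eqX P Q -> eqX P' Q' -> eqX (P + P') (Q + Q').
Proof. by move=> h h'; rewrite /eqX opprD addrACA dvdp_add. Qed.

Lemma eqX_sum (I : Type) (r : seq I) (F G : I -> {poly K}) :
  (forall i, eqX (F i) (G i)) -> eqX (\sum_(i <- r) F i) (\sum_(i <- r) G i).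
Proof.
move=> h; elim: r => [|i r IH]; first by rewrite !big_nil eqX_refl.
by rewrite !big_cons eqXD.
Qed.

Lemma eqXM P Q P' Q' : eqX P Q -> eqX P' Q' -> eqX (P * P') (Q * Q').
Proof.
move=> h h'; rewrite /eqX [_ - _](_ : _ = (P - Q) * P' + Q * (P' - Q')); last by ring.
by apply: dvdp_add; [exact: dvdp_mulr|exact: dvdp_mull].
Qed.

Lemma eqX_exp P Q i : eqX P Q -> eqX (P ^+ i) (Q ^+ i).
Proof.
by move=> h; elim: i => [|i IH]; rewrite ?eqX_refl // !exprS eqXM.
Qed.

End Congruence.

(** * The auxiliary polynomial and the count of solutions *)

Section Stepanov.
Variables (p : nat) (p_pr : prime p) (Om : closedFieldType).
Variable emb : {rmorphism 'F_p -> Om}.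
Variable f : {poly 'F_p}.
Variables (d m : nat) (a : 'F_p).
Hypotheses (p2 : (2 < p)%N) (d0 : (0 < d)%N) (dp : (d < p)%N).
Hypotheses (sf : size f = d.+1) (m0 : (0 < m)%N).
Let fO := map_poly emb f.
Notation pchOm := (rmorph_pchar emb (pchar_Fp p_pr)).

(* The auxiliary polynomial is [\sum k_ij g^i X^(jq)] with [i < p], [j < B] and
   [size k_ij <= A]; it is made to vanish to order [M] at each solution, which costs
   [M * D] linear conditions. *)
Let M := (p ^ m)%N.
Let P1 := (p ^ m.-1)%N.
Let A := (p ^ (2 * m).-1)%N.
Let B := (P1 + d + 1)%N.
Let D := (A + B + p.-1 * d * P1)%N.

Let ME : M = (p * P1)%N. Proof. by rewrite /M /P1 -expnS prednK. Qed.
Let AE : A = (M * P1)%N. Proof. by rewrite /M /P1 /A -expnD; congr expn; lia. Qed.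
Let P1_gt0 : (0 < P1)%N. Proof. by rewrite expn_gt0 prime_gt0. Qed.

(** Since p A = M^2, the claim is D < B M. The summand [d + 1] of [B] provides d M + M, where d M =
    d p P1 absorbs the term [p.-1 * d * P1] of [D], and p > 2 leaves room for the rest. *)
Let count_gt : (M * D < p * B * A)%N.
Proof.
rewrite /D /B AE; have {1 3}-> : M = (p * P1)%N by [].
have : (M * P1 + (P1 + d + 1) + p.-1 * d * P1 < (P1 + d + 1) * M)%N.
  by move: ME P1_gt0 p2 d0; case: p => // k; rewrite /= ; nia.
by move: ME P1_gt0 p2 => -> ? ? ?; nia.
Qed.

(** At a point of the field with p^n elements, its value is the trace of f. *)
Definition trace_poly n : {poly Om} := \sum_(i < n) fO ^+ (p ^ i).

Lemma size_trace_poly n : (0 < n)%N -> size (trace_poly n) = (d * p ^ n.-1).+1.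
Proof.
have szX i : size (fO ^+ (p ^ i)) = (d * p ^ i).+1.
  have f0 : fO != 0 by rewrite -size_poly_eq0 size_map_poly sf.
  rewrite -[LHS]prednK ?size_poly_gt0 ?expf_neq0 //.
  by rewrite size_exp size_map_poly sf.
case: n => // n _; elim: n => [|n IH] /=.
  by rewrite /trace_poly big_ord1 szX.
rewrite /trace_poly big_ord_recr /= addrC size_polyDl szX // IH /= ltnS.
by rewrite ltn_pmul2l // ltn_exp2l // prime_gt1.
Qed.

Let I : finType := ('I_p * 'I_B * 'I_A)%type.
Let J : finType := ('I_M * 'I_D)%type.
Let q := (p ^ (2 * m))%N.
Let g := trace_poly (2 * m).

Let hb (k : I) : {poly Om} := 'X^(k.2) * g ^+ k.1.1 * 'X^(k.1.2 * q).

(* [Hb k] is a bivariate stand-in for [hb k]: at a solution [x], its specialization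
   is congruent modulo ['X^M] to [hb k] expanded around [x], because Frobenius powers
   of exponent at least [M] look constant to that order. *)
Let tX : {poly {poly Om}} := 'X + 'X%:P.
Let fT : {poly {poly Om}} := \sum_(i < d.+1) (fO`_i)%:P%:P * tX ^+ i.
Let dif : {poly {poly Om}} :=
  \sum_(i < m) (fT ^+ (p ^ i) - (fO ^+ (p ^ i))%:P) + (emb a)%:P%:P.
Let Hb (k : I) : {poly {poly Om}} := tX ^+ k.2 * dif ^+ k.1.1 * ('X^(k.1.2))%:P.

Let tX_deg : coef_deg 1 tX.
Proof.
move=> l; rewrite coefD coefX coefC (leq_trans (size_polyD _ _)) // geq_max.
by apply/andP; split; case: (l == _); rewrite ?size_polyX ?size_poly0 ?size_poly1.
Qed.

Let fT_deg : coef_deg d fT.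
Proof.
apply: coef_deg_sum => i; apply: (@coef_deg_le _ (0 + 1 * i)).
  by rewrite add0n mul1n -ltnS.
apply: coef_degM; last exact: coef_degX.
by apply: coef_degC; rewrite size_polyC leq_b1.
Qed.

Let dif_deg : coef_deg (d * P1) dif.
Proof.
apply: coef_degD; last by apply: coef_degC; rewrite size_polyC (leq_trans (leq_b1 _)).
apply: coef_deg_sum => i.
have le : (d * p ^ i <= d * P1)%N.
  by rewrite leq_mul2l leq_exp2l ?prime_gt1 // orbC -ltnS prednK // ltn_ord.
apply: coef_degD; first by apply: coef_deg_le le _; apply: coef_degX.
apply/coef_degN/coef_degC; rewrite (leq_trans (size_poly_exp_leq _ _)) //.
by rewrite size_map_poly sf ltnS.
Qed.

Let Hb_deg (k : I) : coef_deg (k.2 + d * P1 * k.1.1 + k.1.2) (Hb k).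
Proof.
apply: coef_degM; first apply: coef_degM; last by apply: coef_degC; rewrite size_polyXn.
  by rewrite -[X in coef_deg X _]mul1n; apply: coef_degX.
exact: coef_degX.
Qed.

Let Hb_size (k : I) t : (size ((Hb k)`_t)%R <= D)%N.
Proof.
apply: leq_trans (Hb_deg k t) _; case: k => -[i j] l /=.
have := ltn_ord i; have := ltn_ord j; have := ltn_ord l.
have : (d * P1 * i <= p.-1 * d * P1)%N.
  have: (i <= p.-1)%N by have := ltn_ord i; lia.
  by move=> le; rewrite mulnC -[X in (_ <= X)%N]mulnA leq_mul2r le orbT.
rewrite /D; lia.
Qed.

Let ev (x : Om) : {poly {poly Om}} -> {poly Om} := map_poly (horner_eval x).
Let evD x P Q : ev x (P + Q) = ev x P + ev x Q. Proof. exact: rmorphD. Qed.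
Let evB x P Q : ev x (P - Q) = ev x P - ev x Q. Proof. exact: rmorphB. Qed.
Let evM x P Q : ev x (P * Q) = ev x P * ev x Q. Proof. exact: rmorphM. Qed.
Let evX x P i : ev x (P ^+ i) = ev x P ^+ i. Proof. exact: rmorphXn. Qed.
Let evC x c : ev x c%:P = (c.[x])%:P. Proof. by rewrite /ev map_polyC. Qed.
Let ev_sum x (T : Type) (r : seq T) F :
  ev x (\sum_(k <- r) F k) = \sum_(k <- r) ev x (F k).
Proof. exact: rmorph_sum. Qed.
Let shiftp (x : Om) (h : {poly Om}) := h \Po ('X + x%:P).

Let ev_tX x : ev x tX = 'X + x%:P.
Proof.
by rewrite evD evC hornerX /ev map_polyX.
Qed.

Let ev_fT x : ev x fT = shiftp x fO.
Proof.
rewrite /shiftp comp_polyE size_map_poly sf /fT ev_sum.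
by apply: eq_bigr => i _; rewrite evM evX evC hornerC ev_tX mul_polyC.
Qed.

Let sol (x : Om) := (x ^+ q == x) && (\sum_(i < 2 * m) fO.[x] ^+ (p ^ i) == emb a).

Let polyfrobB i (P Q : {poly Om}) : (P - Q) ^+ (p ^ i) = P ^+ (p ^ i) - Q ^+ (p ^ i).
Proof.
have pchP : p \in [pchar {poly Om}] by rewrite (rmorph_pchar (polyC \o emb)) ?pchar_Fp.
have -> : P ^+ (p ^ i) = (P - Q + Q) ^+ (p ^ i) by rewrite subrK.
by rewrite [in RHS]exprDn_pchar ?addrK // pnatX pnatE // pchP.
Qed.

(** For i >= m the power f(x + X)^(p^i) is congruent to its constant term. The trace equation at x
    trades these high constant terms for a minus the low ones, which brings the degree in x from d
    p^(2m-1) down to d p^(m-1). *)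
Let g_eqX x : sol x -> eqX M (shiftp x g) (ev x dif).
Proof.
move=> /andP[_ /eqP tr].
have dv i : (m <= i)%N ->
    'X^M %| (shiftp x fO) ^+ (p ^ i) - (fO.[x] ^+ (p ^ i))%:P.
  move=> mi; rewrite polyC_exp -polyfrobB.
  have /(dvdp_exp2r (p ^ i)) : 'X %| shiftp x fO - (fO.[x])%:P.
    rewrite -['X]subr0 -polyC0 -root_factor_theorem rootE /shiftp.
    by rewrite hornerD hornerN hornerC horner_comp !hornerE subrr.
  by apply: dvdp_trans; apply: dvdp_exp2l; rewrite leq_exp2l // prime_gt1.
have -> : ev x dif = \sum_(i < m) ((shiftp x fO) ^+ (p ^ i) - (fO.[x] ^+ (p ^ i))%:P)
    + (emb a)%:P.
  rewrite /dif evD ev_sum evC hornerC; congr (_ + _); apply: eq_bigr => i _.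
  by rewrite evB evX ev_fT evC horner_exp.
rewrite /eqX -tr [X in _ %| X](_ : _ = \sum_(m <= i < 2 * m)
  ((shiftp x fO) ^+ (p ^ i) - (fO.[x] ^+ (p ^ i))%:P)); last first.
  rewrite /g /trace_poly /shiftp [_ \Po _]raddf_sum /= rmorph_sum /=.
  under eq_bigr do rewrite rmorphXn /=.
  rewrite -(big_mkord xpredT (fun i => (fO \Po ('X + x%:P)) ^+ (p ^ i))).
  rewrite -(big_mkord xpredT (fun i => (fO \Po ('X + x%:P)) ^+ (p ^ i)
     - (fO.[x] ^+ (p ^ i))%:P)).
  rewrite -(big_mkord xpredT (fun i => (fO.[x] ^+ (p ^ i))%:P)).
  rewrite opprD addrA !sumrB (@big_cat_nat _ _ _ m) ?leq_pmull //=.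
  rewrite [\sum_(0 <= i < 2 * m) (_%:P)](@big_cat_nat _ _ _ m) ?leq_pmull //=.
  by ring.
rewrite big_nat; elim/big_ind: _ => [|P Q|i /andP[mi _]]; first exact: dvdp0.
  exact: dvdp_add.
exact: dv.
Qed.

Let hb_eqX x (k : I) : sol x -> eqX M (shiftp x (hb k)) (ev x (Hb k)).
Proof.
move=> sx; rewrite /shiftp /hb /Hb !evM !evX evC ev_tX !comp_polyM.
apply: eqXM; first apply: eqXM; first by rewrite comp_Xn_poly eqX_refl.
  by rewrite [X in eqX _ X _]rmorphXn; apply: eqX_exp; apply: g_eqX.
rewrite hornerXn comp_Xn_poly mulnC !exprM polyC_exp.
apply: eqX_exp.
(* Because x^q = x, the q-th power of X + x is X^q + x, congruent to x modulo X^M. Hence 'X^(j q) is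
   represented by the j-th power of the inner variable alone. *)
have /andP[/eqP xq _] := sx.
have -> : ('X + x%:P) ^+ q = 'X^q + x%:P.
  have := @polyfrobB (2 * m) ('X + x%:P) x%:P; rewrite addrK -polyC_exp -/q xq.
  by move/eqP; rewrite eq_sym subr_eq => /eqP.
by rewrite /eqX addrK dvdp_exp2l // /M /q leq_exp2l ?prime_gt1 // leq_pmull.
Qed.

Let A_gt0 : (0 < A)%N. Proof. by rewrite expn_gt0 prime_gt0. Qed.
Let qE : q = (p * A)%N. Proof. by rewrite /q /A -expnS prednK // muln_gt0. Qed.
Let size_g : size g = (d * A).+1.
Proof. by rewrite /g size_trace_poly // muln_gt0. Qed.
Let g_neq0 : g != 0. Proof. by rewrite -size_poly_eq0 size_g. Qed.

Let size_blk (k : {poly Om}) (i j : nat) : k != 0 ->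
  size (k * (g ^+ i * 'X^(j * q))) = (size k + (i * d + j * p) * A)%N.
Proof.
move=> k0.
have gi0 : g ^+ i != 0 by rewrite expf_neq0.
have sgi : size (g ^+ i) = (i * d * A).+1.
  by rewrite -[LHS]prednK ?size_poly_gt0 // size_exp size_g /= mulnC mulnA.
rewrite mulrA size_mulXn ?mulf_neq0 // size_mul // sgi addnS /= qE.
by rewrite mulnDl !mulnA addnC addnA.
Qed.

Let hb_size (k : I) : (size (hb k) <= A + p.-1 * d * A + (P1 + d) * q)%N.
Proof.
rewrite /hb -mulrA size_blk ?monic_neq0 ?monicXn // size_polyXn qE mulnDl.
case: k => -[i j] l /=; rewrite addnA leq_add //.
  by rewrite leq_add // leq_mul2r leq_mul2r -ltnS prednK ?prime_gt0 // ltn_ord !orbT.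
have lej : (j <= P1 + d)%N by have := ltn_ord j; rewrite {2}/B addn1 ltnS.
by rewrite -mulnA leq_mul2r lej orbT.
Qed.

(** Modulo p only i d remains; d is prime to p and i < p, so i is determined, and then j. *)
Let key_inj (i i' : 'I_p) (j j' : 'I_B) :
  (i * d + j * p = i' * d + j' * p)%N -> (i, j) = (i', j').
Proof.
move=> e.
have ei : i = i'.
  have := congr1 (modn^~ p) e; rewrite !(addnC _ (_ * p)%N) !modnMDl => /eqP.
  have cop : coprime p d by rewrite prime_coprime // gtnNdvd.
  clear e; wlog lei : i i' / (i <= i')%N => [H|].
    case/orP: (leq_total i i') => l h; [exact: (H i i')|].
    by apply: esym; apply: (H i' i l); rewrite eq_sym.
  rewrite eq_sym eqn_mod_dvd ?leq_mul2r ?lei ?orbT // -mulnBl Gauss_dvdl // => dv.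
  apply/val_inj/eqP; rewrite /= eqn_leq lei -subn_eq0 /=.
  apply: contraTT dv; rewrite -lt0n => gt0; rewrite gtnNdvd //.
  by rewrite (leq_ltn_trans (leq_subr _ _)).
rewrite ei; congr (_, _); apply: val_inj => /=; move: e; rewrite ei => /addnI/eqP.
by rewrite eqn_pmul2r ?prime_gt0 // => /eqP.
Qed.

(* The [g ^+ i * 'X^(j * q)] have degrees that are distinct multiples of [A],
   so blocks with coefficients of degree below [A] cannot cancel. *)
Let nonvanish (u : I -> Om) : (exists k, u k != 0) -> \sum_k u k *: hb k != 0.
Proof.
move=> [k0 uk0].
pose blk (ij : 'I_p * 'I_B) : {poly Om} := \sum_(l < A) u (ij, l) *: 'X^l.
have sz_blk ij : (size (blk ij) <= A)%N.
  rewrite (leq_trans (size_sum _ _ _)) //; apply/bigmax_leqP => l _.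
  by rewrite (leq_trans (size_scale_leq _ _)) // size_polyXn.
have coef_blk ij (l : 'I_A) : (blk ij)`_l = u (ij, l).
  rewrite /blk coef_sum (bigD1 l) //= coefZ coefXn eqxx mulr1 big1 ?addr0 // => l' l'l.
  by rewrite coefZ coefXn (inj_eq val_inj) eq_sym (negPf l'l) mulr0.
have -> : \sum_k u k *: hb k =
    \sum_ij blk ij * (g ^+ (ij.1 : nat) * 'X^(ij.2 * q)).
  transitivity (\sum_(k : I) u (k.1, k.2) *: hb (k.1, k.2)).
    by apply: eq_bigr => -[].
  rewrite -(pair_bigA _ (fun ij l => u (ij, l) *: hb (ij, l))) /=.
  apply: eq_bigr => ij _; rewrite /blk mulr_suml; apply: eq_bigr => l _.
  by rewrite /hb -scalerAl mulrA.
pose key (ij : 'I_p * 'I_B) := (ij.1 * d + ij.2 * p)%N.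
have blk0 : blk k0.1 != 0.
  apply: contra_neq uk0 => b0; case: k0 b0 => ij l /= b0.
  by rewrite -coef_blk b0 coef0.
case: (@arg_maxnP _ k0.1 (fun ij => blk ij != 0) key blk0) => ij bij kmax.
rewrite (bigD1 ij) //= -size_poly_gt0 size_polyDl.
  by rewrite size_blk // addn_gt0 size_poly_gt0 bij.
rewrite size_blk //.
apply: (@leq_ltn_trans (key ij * A)%N); last first.
  by rewrite -[X in (X < _)%N]add0n ltn_add2r size_poly_gt0.
rewrite (leq_trans (size_sum _ _ _)) //; apply/bigmax_leqP => ij' nij.
have [->|b0] := eqVneq (blk ij') 0; first by rewrite mul0r size_poly0.
rewrite size_blk // (leq_trans (leq_add (sz_blk ij') (leqnn _))) // -mulSn leq_mul2r.
apply/orP; right; rewrite -/(key ij') ltn_neqAle [X in _ && X](kmax _ b0) andbT.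
apply: contra_neq nij => e; case: ij ij' e {bij kmax b0} => i j [i' j'].
exact: key_inj.
Qed.

Lemma stepanov :
  (count (fun x => (\sum_(i < 2 * m) fO.[x] ^+ (p ^ i))%R == emb a)
     (frob_fixed p Om (2 * m)) <= p ^ (2 * m).-1 + 2 * d * p ^ m)%N.
Proof.
have mm0 : (0 < 2 * m)%N by rewrite muln_gt0.
set rs := [seq x <- frob_fixed p Om (2 * m) |
  \sum_(i < 2 * m) fO.[x] ^+ (p ^ i) == emb a].
have solrs x : x \in rs -> sol x.
  by rewrite mem_filter mem_frob_fixed // /sol andbC.
have urs : uniq rs by rewrite filter_uniq // uniq_frob_fixed.
have ltJI : (#|J| < #|I|)%N by rewrite !card_prod !card_ord count_gt.
(* The equations make the coefficients of index t < M vanish identically in the inner variable, so a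
   single choice of [u] serves all solutions x at once. *)
have [u [un0 uE]] := underdetermined_system (fun (k : I) (t : J) => ((Hb k)`_t.1)`_t.2) ltJI.
pose h := \sum_k u k *: hb k.
have hn0 : h != 0 by apply: nonvanish.
have hdiv x : x \in rs -> ('X - x%:P) ^+ M %| h.
  move=> /solrs sx.
  have XM : 'X^M %| shiftp x h.
    pose HH := \sum_k (u k)%:P%:P * Hb k.
    have : eqX M (shiftp x h) (ev x HH).
      rewrite /shiftp /h /HH [_ \Po _]raddf_sum /= ev_sum.
      apply: eqX_sum => k; rewrite linearZ /= evM evC hornerC.
      by rewrite -mul_polyC; apply: eqXM; [apply: eqX_refl|apply: hb_eqX].
    suff dv : 'X^M %| ev x HH by rewrite /eqX dvdp_subl.
    have -> : ev x HH = 'X^M * drop_poly M (ev x HH).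
      rewrite -[LHS](poly_take_drop M) [X in X + _](_ : _ = 0) ?add0r 1?mulrC //.
      apply/polyP => t; rewrite coef_take_poly coef0; case: ifP => // tM.
      rewrite coef_map /=; suff -> : HH`_t = 0 by rewrite /horner_eval horner0.
      apply/polyP => s; rewrite coef0 /HH coef_sum coef_sum.
      case: (ltnP s D) => sD.
        rewrite -[RHS](uE (Ordinal tM, Ordinal sD)) /=; apply: eq_bigr => k _.
        by rewrite !coefCM.
      rewrite big1 // => k _; rewrite !coefCM [_`_s]nth_default ?mulr0 //.
      exact: leq_trans (Hb_size k t) sD.
    exact: dvdp_mulIl.
  have /dvdpP[r rE] := XM.
  apply/dvdpP; exists (r \Po ('X - x%:P)).
  have := congr1 (fun P => P \Po ('X - x%:P)) rE.
  rewrite /shiftp -comp_polyA comp_polyD comp_polyX comp_polyC subrK comp_polyXr => ->.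
  by rewrite comp_polyM comp_Xn_poly.
have /(dvdp_leq hn0) := dvdp_prod_exp urs hdiv.
have -> : size ((\prod_(x <- rs) ('X - x%:P)) ^+ M) = (size rs * M).+1.
  rewrite -[LHS]prednK ?size_poly_gt0 ?expf_neq0 ?monic_neq0 ?monic_prod_XsubC //.
  by rewrite size_exp size_prod_XsubC.
move=> le1.
have le2 : (size h <= A + p.-1 * d * A + (P1 + d) * q)%N.
  rewrite (leq_trans (size_sum _ _ _)) //; apply/bigmax_leqP => k _.
  by rewrite (leq_trans (size_scale_leq _ _)).
have le3 := leq_trans le1 le2.
(* Vanishing to order M gives [size rs * M < size h]. As q = p A = M^2, the first two terms of the
   bound on [size h] are at most d M^2, and P1 M^2 = A M; dividing by M leaves A + 2 d M. *)
rewrite -size_filter -/rs.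
have M0 : (0 < M)%N by rewrite expn_gt0 prime_gt0.
rewrite -(leq_pmul2r M0); apply: leq_trans (ltnW le3) _.
have -> : q = (M * M)%N by rewrite /q /M -expnD; congr expn; lia.
rewrite -/A -/M.
have lA : (A + p.-1 * d * A <= d * M * M)%N.
  have -> : (d * M * M = p * (d * A))%N by rewrite AE {2}ME; ring.
  rewrite -{2}(prednK (prime_gt0 p_pr)) mulSn -mulnA leq_add2r.
  by rewrite leq_pmull.
have -> : ((A + 2 * d * M) * M = d * M * M + (P1 + d) * (M * M))%N by rewrite AE; ring.
by rewrite leq_add2r.
Qed.

End Stepanov.

(** * Weil's bound *)

Section PowerSums.
Variable C : numClosedFieldType.

(** Induction through Newton's identity, with the factor l simply dropped. The base 1 + c is the one
    for which the geometric sum of c (1 + c)^j over j < l closes up to (1 + c)^l - 1. *)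
Lemma psum_coef_bound (rs : seq C) (c r : C) : 0 <= c -> 0 <= r ->
    (forall l, (0 < l)%N -> `|\sum_(z <- rs) z ^+ l| <= c * r ^+ l) ->
  forall l, `|(revprod rs)`_l| <= ((1 + c) * r) ^+ l.
Proof.
move=> c0 r0 bnd; elim/ltn_ind => -[_|l IH]; first by rewrite revprod0 normr1.
have := congr1 Num.norm (newton rs l.+1).
rewrite normrM normrN normr_nat => e.
have le1 : `|(revprod rs)`_l.+1| <= l.+1%:R * `|(revprod rs)`_l.+1|.
  by rewrite ler_peMl // ler1n.
apply: le_trans le1 _; rewrite -e.
apply: le_trans (ler_norm_sum _ _ _) _.
apply: (@le_trans _ _ (\sum_(j < l.+1) (1 + c) ^+ j * (c * r ^+ l.+1))).
  apply: ler_sum => j _; rewrite normrM.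
  have lj := ltn_ord j.
  have -> : (1 + c) ^+ j * (c * r ^+ l.+1) =
     ((1 + c) * r) ^+ j * (c * r ^+ (l.+1 - j)).
    by rewrite exprMn -mulrA mulrCA [r ^+ j * _]mulrCA -exprD subnKC // 1?ltnW // mulrCA.
  apply: ler_pM => //; first exact: IH.
  by apply: bnd; rewrite subn_gt0.
have geo k : \sum_(j < k) (1 + c) ^+ j * c = (1 + c) ^+ k - 1.
  elim: k => [|k IHk]; first by rewrite big_ord0 expr0 subrr.
  by rewrite big_ord_recr /= IHk exprS; ring.
under eq_bigr do rewrite mulrA.
rewrite -mulr_suml geo exprMn mulrBl mul1r gerBl.
exact: exprn_ge0.
Qed.

(* The constant does not depend on [r]: applied to the [s]-th powers of fixed
   numbers for all [s], this bounds each of them by the growth rate of their power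
   sums. *)
Lemma psum_root_bound (rs : seq C) (c r : C) : 0 <= c -> 0 < r ->
    (forall l, (0 < l)%N -> `|\sum_(z <- rs) z ^+ l| <= c * r ^+ l) ->
  forall z, z \in rs -> `|z| <= (2%:R * (1 + c)) * r.
Proof.
move=> c0 r0 bnd z zrs.
have cb := psum_coef_bound c0 (ltW r0) bnd.
set K := (1 + c) * r in cb.
have K0 : 0 < K by rewrite mulr_gt0 // ltr_wpDr.
have Kr : 2%:R * K \is Num.real by rewrite realM ?realn ?gtr0_real.
rewrite -mulrA -/K real_leNgt ?normr_real //.
(* Cauchy's root bound: the coefficients are at most K^l, so when |z| > 2K the lower terms add up to
   at most |z|^k - K^k and cannot balance the leading one. *)
apply/negP => zK.
set k := size rs.
have zk : z ^+ k = - \sum_(j < k) (revprod rs)`_j.+1 * z ^+ (k - j.+1).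
  have : (\prod_(w <- rs) ('X - w%:P)).[z] = 0.
    by apply/rootP; rewrite root_prod_XsubC.
  rewrite horner_coef size_prod_XsubC -/k (reindex_inj rev_ord_inj) /= big_ord_recl /=.
  rewrite subSS subn0 => /eqP; rewrite addr_eq0 -[X in _`_X * _]/k => /eqP.
  have -> : (\prod_(w <- rs) ('X - w%:P))`_k = 1.
    by rewrite -[k]subn0 coef_prod_XsubC // revprod0.
  rewrite mul1r => ->; congr (- _); apply: eq_bigr => j _.
  by rewrite /bump /= add1n subSS coef_prod_XsubC // ltn_ord.
have T n : \sum_(j < n) K ^+ j.+1 * `|z| ^+ (n - j.+1) <= `|z| ^+ n - K ^+ n.
  elim: n => [|n IH]; first by rewrite big_ord0 !expr0 subrr.
  rewrite big_ord_recr /= subnn expr0 mulr1.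
  rewrite (eq_bigr (fun j : 'I_n => `|z| * (K ^+ j.+1 * `|z| ^+ (n - j.+1)))); last first.
    by move=> j _; rewrite subSS -(subnSK (ltn_ord j)) [`|z| ^+ _]exprS mulrCA.
  rewrite -mulr_sumr -lerBrDr (le_trans (ler_wpM2l (normr_ge0 z) IH)) //.
  rewrite mulrBr -exprS -addrA lerD2l -opprD lerN2 exprS -mulr2n -mulr_natl mulrA.
  by rewrite ler_wpM2r ?exprn_ge0 ?ltW.
have : `|z| ^+ k <= `|z| ^+ k - K ^+ k.
  rewrite -[X in X <= _]normrX zk normrN.
  apply: le_trans (ler_norm_sum _ _ _) (le_trans _ (T k)).
  by apply: ler_sum => j _; rewrite normrM normrX ler_wpM2r ?exprn_ge0.
by rewrite lerDl oppr_ge0 lt_geF // exprn_gt0.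
Qed.

End PowerSums.

Section Weil.
Variable C : numClosedFieldType.
Hypothesis archC : forall x : C, 0 <= x -> exists n, x < n%:R.

(** If x > y, Bernoulli's inequality makes (x / y)^s grow at least linearly in s, and the
    archimedean hypothesis lets it exceed c. *)
Lemma le_of_exp_le (x y c : C) : 0 <= x -> 0 < y ->
  (forall s, (0 < s)%N -> x ^+ s <= c * y ^+ s) -> x <= y.
Proof.
move=> x0 y0 h; rewrite real_leNgt ?(ger0_real x0) ?(gtr0_real y0) //.
apply/negP => yx.
pose e := x / y - 1.
have e0 : 0 < e by rewrite subr_gt0 ltr_pdivlMr ?mul1r.
have ber s : 1 + s%:R * e <= (x / y) ^+ s.
  elim: s => [|s IH]; first by rewrite mul0r addr0.
  rewrite exprS -{1}[x / y](subrK 1) -/e.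
  apply: le_trans (_ : (e + 1) * (1 + s%:R * e) <= _).
    have -> : (e + 1) * (1 + s%:R * e) = 1 + s.+1%:R * e + s%:R * e ^+ 2.
      by rewrite -natr1; ring.
    by rewrite lerDl mulr_ge0 // exprn_ge0 // ltW.
  by rewrite ler_wpM2l // addr_ge0 // ltW.
have c0 : 0 <= c.
  by have := h 1%N isT; rewrite !expr1 => /(le_trans x0); rewrite pmulr_lge0.
have [n nP] := archC (divr_ge0 c0 (ltW e0)).
have n0 : (0 < n)%N.
  by rewrite -(ltr0n C) (le_lt_trans _ nP) // divr_ge0 // ltW.
have := h n n0; rewrite -ler_pdivrMr ?exprn_gt0 // -expr_div_n.
move/(le_trans (ber n)); move=> le; move: nP; rewrite ltr_pdivrMr // => lt.
by have := lt_le_trans lt (le_trans _ le); rewrite lerDr ler01 ltxx => /(_ isT).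
Qed.

Variables (p : nat) (p_pr : prime p).
Variable psi : 'F_p -> C.
Hypothesis psiD : forall a b, psi (a + b) = psi a * psi b.
Hypothesis psi0 : psi 0 = 1.
Hypothesis psi_neq1 : forall a, a != 0 -> psi a != 1.
Hypothesis psi_norm : forall a, `|psi a| = 1.

Variables (f : {poly 'F_p}) (d : nat).
Hypotheses (d0 : (0 < d)%N) (dp : (d < p)%N).
Hypothesis (sf : size f = d.+1).

Lemma sum_psi : \sum_a psi a = 0.
Proof.
have e : \sum_a psi a = psi 1 * \sum_a psi a.
  rewrite mulr_sumr (reindex_inj (addrI 1)).
  by apply: eq_bigr => a _; rewrite psiD.
apply/eqP; move/eqP: e; rewrite -subr_eq0 -{1}[\sum_a psi a]mul1r -mulrBl mulf_eq0.
by rewrite subr_eq0 eq_sym (negPf (psi_neq1 _)) ?oner_neq0.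
Qed.

Section WithClosure.
Hypothesis p2 : (2 < p)%N.
Variables (Om : closedFieldType) (emb : {rmorphism 'F_p -> Om}).
Let fO := map_poly emb f.
Notation S := (ext_sum emb psi f).
Notation wsum := (weight_sum emb psi f).
Notation pchOm := (rmorph_pchar emb (pchar_Fp p_pr)).
Let tr r (al : Om) := \sum_(i < r) fO.[al] ^+ (p ^ i).

Let tr_fixed r al : (0 < r)%N -> al \in frob_fixed p Om r -> tr r al ^+ p = tr r al.
Proof.
move=> r0; rewrite mem_frob_fixed // => /eqP alr.
rewrite -(pFrobenius_autE pchOm) /tr rmorph_sum /=.
under eq_bigr do rewrite pFrobenius_autE -exprM -expnSr.
case: r r0 alr => // r _ alr.
by rewrite big_ord_recr [RHS]big_ord_recl /= addrC !(horner_frob p_pr) alr expr1.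
Qed.

(** Stepanov's method bounds each [N a] only from above, by [T]. Since psi sums to zero, [N a] may
    be replaced by [N a - T], which has constant sign; the triangle inequality then gives p T -
    p^(2m) = 2 d p^(m+1). *)
Let S_even m : (0 < m)%N -> `|S (2 * m)| <= (2 * d * p)%:R * p%:R ^+ m.
Proof.
move=> m0; have mm0 : (0 < 2 * m)%N by rewrite muln_gt0.
pose N a := count (fun al => tr (2 * m) al == emb a) (frob_fixed p Om (2 * m)).
pose T := (p ^ (2 * m).-1 + 2 * d * p ^ m)%N.
have NT a : (N a <= T)%N by apply: stepanov.
have delta al : al \in frob_fixed p Om (2 * m) -> forall F : 'F_p -> C,
    \sum_a (tr (2 * m) al == emb a)%:R * F a = F (Fp_of emb (tr (2 * m) al)).
  move=> /(tr_fixed mm0) fx F; rewrite (bigD1 (Fp_of emb (tr (2 * m) al))) //=.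
  rewrite (Fp_ofK p_pr) // eqxx mul1r big1 ?addr0 // => a na.
  by rewrite -{1}(@Fp_ofK p p_pr Om emb _ fx) (inj_eq (fmorph_inj emb)) eq_sym (negPf na) mul0r.
have cnt (F : 'F_p -> C) : \sum_a (N a)%:R * F a =
   \sum_(al <- frob_fixed p Om (2 * m)) F (Fp_of emb (tr (2 * m) al)).
  rewrite [RHS]big_seq_cond; transitivity (\sum_(al <- frob_fixed p Om (2 * m) |
      (al \in frob_fixed p Om (2 * m)) && true)
    \sum_a (tr (2 * m) al == emb a)%:R * F a); last first.
    by apply: eq_bigr => al /andP[/delta ->].
  rewrite -big_seq_cond exchange_big /=; apply: eq_bigr => a _.
  rewrite -mulr_suml; congr (_ * _); rewrite /N -sum1_count natr_sum big_mkcond /=.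
  by apply: eq_bigr => al _; case: (_ == _).
have sN : \sum_a (N a)%:R = (p ^ (2 * m))%:R :> C.
  have := cnt (fun => 1); under eq_bigr do rewrite mulr1.
  by move=> ->; rewrite big_const_seq count_predT size_frob_fixed // iter_addr_0.
have -> : S (2 * m) = \sum_a ((N a)%:R - T%:R) * psi a.
  under eq_bigr do rewrite mulrBl.
  by rewrite sumrB -mulr_sumr sum_psi mulr0 subr0 cnt.
apply: le_trans (ler_norm_sum _ _ _) _.
rewrite (eq_bigr (fun a => T%:R - (N a)%:R)) => [|a _]; last first.
  by rewrite normrM psi_norm mulr1 distrC ger0_norm // subr_ge0 ler_nat.
rewrite sumrB sN big_const card_Fp // iter_addr_0 -mulrnA lerBlDr -natrX -natrM -natrD ler_nat.
rewrite /T mulnDl -expnSr prednK // addnC leq_add2r.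
by rewrite -!mulnA [(p ^ m * p)%N]mulnC.
Qed.

(** The inverse roots of the L-polynomial with coefficients [wsum k], padded with zeros to length d
    - 1. The coefficients are reversed so that [wsum 0 = 1] makes the polynomial monic. *)
Let om : seq C := closed_roots (\poly_(i < d) wsum (d.-1 - i)).

Let omE : \poly_(i < d) wsum (d.-1 - i) = \prod_(z <- om) ('X - z%:P).
Proof.
apply: closed_rootsE; rewrite monicE lead_coefE; apply/eqP.
have sp : size (\poly_(i < d) wsum (d.-1 - i)) = d.
  by apply: size_poly_eq; rewrite subnn weight_sum0 // oner_neq0.
by rewrite sp coef_poly prednK // leqnn subnn weight_sum0.
Qed.

Let size_om : size om = d.-1.
Proof.
apply/eqP; rewrite -eqSS -(size_prod_XsubC _ id) -omE prednK //.
by apply/eqP/size_poly_eq; rewrite subnn weight_sum0 // oner_neq0.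
Qed.

Let revom j : (revprod om)`_j = wsum j.
Proof.
case: (ltnP j d) => jd; last first.
  rewrite (@weight_sum_eq0 p p_pr Om emb C psi psiD f d) // nth_default //.
  by rewrite (leq_trans (size_revprod _)) // size_om prednK.
rewrite -coef_prod_XsubC size_om; last by lia.
rewrite -omE coef_poly ifT; last by lia.
by congr (wsum _); lia.
Qed.

(** [weight_sum_rec] and Newton's identity for [om] are the same recursion up to sign, with the same
    coefficients by [revom]. *)
Let S_psum l : (0 < l)%N -> S l = - \sum_(z <- om) z ^+ l.
Proof.
elim/ltn_ind: l => -[//|l] IH _.
have e2 : l.+1%:R * wsum l.+1 = \sum_(j < l.+1) wsum j * S (l.+1 - j).
  rewrite (weight_sum_rec p_pr emb psiD f) big_add1 big_mkord (reindex_inj rev_ord_inj) /=.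
  apply: eq_bigr => i _; have := ltn_ord i => li.
  by rewrite mulrC; congr (wsum _ * S _); lia.
have := newton om l.+1; rewrite revom mulNr e2.
rewrite big_ord_recl [in X in _ = X]big_ord_recl revom weight_sum0 // !mul1r subn0.
rewrite (eq_bigr (fun i : 'I_l => - (wsum i.+1 * S (l.+1 - i.+1)))); last first.
  move=> i _; have := ltn_ord i => li; rewrite revom lift0 IH ?mulrN ?opprK //.
    by lia.
  by rewrite subn_gt0.
rewrite sumrN opprD => /addIr ->; by rewrite opprK.
Qed.

(** The l-th power sum of the w^(2s) is - S(2sl), an even index as Stepanov's estimate requires.
    Hence [psum_root_bound] applies with c = 2 d p for every s, and r = p^s. *)
Let om_bound z : z \in om -> `|z| ^+ 2 <= p%:R.
Proof.
move=> zom; apply: (@le_of_exp_le _ _ (2%:R * (1 + (2 * d * p)%:R))).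
- exact: exprn_ge0.
- by rewrite ltr0n prime_gt0.
move=> s s0; rewrite -exprM -normrX.
apply: (@psum_root_bound _ [seq w ^+ (2 * s) | w <- om]).
- exact: ler0n.
- by rewrite exprn_gt0 // ltr0n prime_gt0.
- move=> l l0; rewrite big_map.
  under eq_bigr do rewrite -exprM -mulnA.
  have sl : (0 < s * l)%N by rewrite muln_gt0 s0.
  have sl2 : (0 < 2 * (s * l))%N by rewrite muln_gt0.
  rewrite -normrN -(S_psum sl2) -exprM.
  exact: S_even.
- exact: map_f.
Qed.

Let S1E : S 1 = \sum_(x : 'F_p) psi f.[x].
Proof.
rewrite /ext_sum (perm_big [seq emb x | x <- enum 'F_p]); last first.
  apply: uniq_perm; first exact: uniq_frob_fixed.
    by rewrite (map_inj_uniq (fmorph_inj emb)) enum_uniq.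
  move=> x; rewrite mem_frob_fixed // expn1; apply/eqP/mapP => [|[a _ ->]].
    by move=> /(fixed_emb p_pr emb)[a <-]; exists a; rewrite ?mem_enum.
  by rewrite -rmorphXn /= Fp_exp.
rewrite big_map big_enum; apply: eq_bigr => x _.
by rewrite big_ord1 expn0 expr1 horner_map embK.
Qed.

Lemma weil_closure : `|\sum_(x : 'F_p) psi f.[x]| ^+ 2 <= (d.-1 ^ 2 * p)%:R.
Proof.
rewrite -S1E S_psum // normrN.
have sq0 : 0 <= sqrtC (p%:R : C) by rewrite sqrtC_ge0.
have le1 : `|\sum_(z <- om) z ^+ 1| <= (d.-1)%:R * sqrtC p%:R.
  apply: le_trans (ler_norm_sum _ _ _) _.
  rewrite -size_om -sum1_size natr_sum mulr_suml big_seq_cond [X in _ <= X]big_seq_cond.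
  apply: ler_sum => z /andP[zom _]; rewrite mul1r expr1.
  by rewrite -(ler_pXn2r (n := 2)) ?nnegrE // sqrtCK om_bound.
apply: le_trans (lerXn2r 2 _ _ le1) _; rewrite ?nnegrE ?mulr_ge0 //.
by rewrite exprMn sqrtCK natrM natrX.
Qed.

End WithClosure.

(** The count above assumes p > 2, which d < p guarantees as soon as d >= 2. For d = 1 the
    polynomial permutes the field and the sum is zero. *)
Lemma weil_bound : `|\sum_(x : 'F_p) psi f.[x]| ^+ 2 <= (d.-1 ^ 2 * p)%:R.
Proof.
have [d1|d_neq1] := eqVneq d 1%N; last first.
  have [Om [emb _]] := countable_algebraic_closure 'F_p.
  by apply: (weil_closure _ emb); lia.
rewrite -[X in `|X|](_ : 0 = _) ?normr0 ?expr0n ?ler0n //.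
rewrite -[LHS]sum_psi [LHS](@reindex_inj _ _ _ _ (fun x => f.[x])) // => x y /eqP.
have f1 : f`_1 != 0 by have := lead_coef_eq0 f; rewrite lead_coefE -size_poly_eq0 sf d1 => ->.
rewrite !horner_coef sf d1 !big_ord_recl !big_ord0 !addr0 !expr0 !expr1.
by rewrite (inj_eq (addrI _)) (inj_eq (mulfI f1)) => /eqP.
Qed.

End Weil.

(** * Fourier expansion of the kernel *)

Lemma big_ord_mul (V : nmodType) (m n : nat) (F : nat -> V) :
  \sum_(i < m * n) F i = \sum_(a < m) \sum_(b < n) F (a * n + b)%N.
Proof.
elim: m => [|m IH]; first by rewrite !big_ord0.
rewrite big_ord_recr /= -IH mulSnr.
rewrite -!(big_mkord xpredT F) (@big_cat_nat _ _ _ (m * n)) ?leq_addr //=.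
by congr (_ + _); rewrite -{1}[(m * n)%N]add0n big_addn addKn big_mkord;
   apply: eq_bigr => i _; rewrite addnC.
Qed.

Section RootsOfUnity.
Variable C : numClosedFieldType.

Lemma unity_norm (n : nat) (w : C) : (0 < n)%N -> w ^+ n = 1 -> `|w| = 1.
Proof.
move=> n0 wn; have /eqP := congr1 Num.norm wn.
by rewrite normrX normr1 pexprn_eq1 ?normr_ge0 // eqn0Ngt n0 => /eqP.
Qed.

Lemma norm1_conj (w : C) : `|w| = 1 -> w^* = w^-1.
Proof. by move=> w1; rewrite invC_norm w1 expr1n invr1 mul1r. Qed.

Lemma geom_unity (n : nat) (w : C) : w ^+ n = 1 ->
  \sum_(k < n) w ^+ k = if w == 1 then n%:R else 0.
Proof.
move=> wn; case: eqP => [->|/eqP w1].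
  under eq_bigr do rewrite expr1n.
  by rewrite sumr_const card_ord.
have /esym/eqP := subrX1 w n; rewrite wn subrr mulf_eq0 subr_eq0 (negPf w1) /=.
by move/eqP.
Qed.

End RootsOfUnity.

Definition kpoly (F : unitRingType) (u : F) : F := 2^-1 - u + u ^+ 2.

Section Kernel.
Variable C : numClosedFieldType.
Variables (M : nat) (M0 : (0 < M)%N) (zeta : C).
Hypothesis zetaP : M.-primitive_root zeta.

Definition kern (a b : nat) : C :=
  kpoly `|(a %% M)%:R / M%:R - (b %% M)%:R / M%:R|.
Definition kcoef (k : nat) : C :=
  M%:R^-1 * \sum_(j < M) kpoly (j%:R / M%:R) * zeta ^- (k * j).

Let M_neq0 : M%:R != 0 :> C. Proof. by rewrite pnatr_eq0 -lt0n. Qed.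
Let zetaM : zeta ^+ M = 1. Proof. exact: prim_expr_order. Qed.

Lemma zeta_norm : `|zeta| = 1. Proof. exact: unity_norm zetaM. Qed.
Let zeta_neq0 : zeta != 0. Proof. by rewrite -normr_eq0 zeta_norm oner_neq0. Qed.

Lemma zeta_ortho a c : \sum_(k < M) zeta ^+ (k * a) * zeta ^- (k * c) =
  if a == c %[mod M] then M%:R else 0.
Proof.
rewrite (eq_bigr (fun k : 'I_M => (zeta ^+ a / zeta ^+ c) ^+ k)); last first.
  by move=> k _; rewrite expr_div_n -!exprM ![(k * _)%N]mulnC.
rewrite geom_unity; last by rewrite expr_div_n -!exprM !(mulnC _ M) !exprM zetaM !expr1n divr1.
by rewrite -(eq_prim_root_expr zetaP) -(inj_eq (mulIf (expf_neq0 c zeta_neq0))) divfK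
  ?expf_neq0 // mul1r.
Qed.

Lemma kpoly_onem (u : C) : kpoly (1 - u) = kpoly u.
Proof. rewrite /kpoly; ring. Qed.

(** The symmetry u -> 1 - u of [kpoly] makes the kernel a function of a - b modulo M despite the
    absolute value, so Fourier inversion on Z/M applies. *)
Lemma kern_fourier a b :
  kern a b = \sum_(k < M) kcoef k * (zeta ^+ (k * a) * (zeta ^+ (k * b))^*).
Proof.
transitivity (\sum_(j < M) kpoly (j%:R / M%:R) * (a == b + j %[mod M])%:R : C);
  last first.
  rewrite [RHS](eq_bigr (fun k : 'I_M => \sum_(j < M) M%:R^-1 * kpoly (j%:R / M%:R) *
      (zeta ^+ (k * a) * zeta ^- (k * (b + j))))); last first.
    move=> k _; rewrite /kcoef -mulrA mulr_suml mulr_sumr; apply: eq_bigr => j _.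
    rewrite norm1_conj ?normrX ?zeta_norm ?expr1n // mulnDr exprD invfM; ring.
  rewrite [RHS]exchange_big /=; apply: eq_bigr => j _; rewrite -mulr_sumr zeta_ortho.
  by case: eqP => _; rewrite ?mulr0 // mulr1 mulrAC mulVf ?mul1r.
rewrite /kern; set a' := (a %% M)%N; set b' := (b %% M)%N.
have a'M : (a' < M)%N by rewrite ltn_mod.
have b'M : (b' < M)%N by rewrite ltn_mod.
have [j [jM jP jE]] : exists j : nat, [/\ (j < M)%N, a' = ((b' + j) %% M)%N &
    kpoly `|a'%:R / M%:R - b'%:R / M%:R| = kpoly (j%:R / M%:R : C) ].
  have [le|lt] := leqP b' a'.
    exists (a' - b')%N; split; first by lia.
      by rewrite subnKC // modn_small.
    by rewrite natrB // mulrBl ger0_norm // subr_ge0 ler_wpM2r ?invr_ge0 ?ler_nat.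
  exists (M + a' - b')%N; split; first by lia.
    by rewrite subnKC ?(leq_trans (ltnW b'M)) ?leq_addr // modnDl modn_small.
  have neg : a'%:R / M%:R - b'%:R / M%:R <= 0 :> C.
    by rewrite subr_le0 ler_wpM2r ?invr_ge0 ?ler0n // ler_nat ltnW.
  rewrite (ler0_norm neg).
  rewrite natrB ?natrD; last by lia.
  rewrite -kpoly_onem; congr kpoly; field.
  exact: M_neq0.
rewrite jE (bigD1 (Ordinal jM)) //= big1 ?addr0.
  by rewrite -(modnDml b j) -/b' -jP eqxx mulr1.
move=> i; rewrite -val_eqE /= => ij; rewrite (_ : (a == b + i %[mod M]) = false) ?mulr0 //.
apply/negP => /eqP; rewrite -/a' jP -(modnDml b i) -/b' => /eqP.
by rewrite eqn_modDl !modn_small // eq_sym (negPf ij).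
Qed.

(** At k = 0 this is a mean of values 1/4 + (1/2 - u)^2. At other k the sum against powers of w,
    multiplied by (1 - w)(1 - 1/w) = |1 - w|^2, telescopes to the boundary value 2/M. *)
Lemma kcoef_ge0 k : (k < M)%N -> 0 <= kcoef k.
Proof.
move=> kM; rewrite /kcoef mulr_ge0 ?invr_ge0 ?ler0n //.
case: k kM => [_|k kM].
  apply: sumr_ge0 => j _; rewrite mul0n expr0 invr1 mulr1 /kpoly.
  set u := _ / _.
  have u0 : 0 <= u by rewrite divr_ge0.
  have -> : 2^-1 - u + u ^+ 2 = 2^-2 + (2^-1 - u) ^+ 2 :> C.
    by field; rewrite ?pnatr_eq0.
  have ur : 2^-1 - u \is Num.real by rewrite realB ?realV ?realn ?(ger0_real u0).
  apply: addr_ge0; first by rewrite invr_ge0 exprn_ge0.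
  by rewrite real_exprn_even_ge0.
pose w := (zeta ^+ k.+1)^-1.
have wn : `|w| = 1 by rewrite normfV normrX zeta_norm expr1n invr1.
have w0 : w != 0 by rewrite -normr_eq0 wn oner_neq0.
have wM : w ^+ M = 1 by rewrite exprVn exprAC zetaM expr1n invr1.
have w1 : w - 1 != 0.
  rewrite subr_eq0 -invr_eq1 invrK -(expr0 zeta) (eq_prim_root_expr zetaP).
  by rewrite mod0n modn_small.
under eq_bigr do rewrite exprM -exprVn -/w.
(* [G] solves [G (j + 1) - G j = (1 - w) (1 - w^-1) kpoly (j / M) w ^ j]. *)
pose al := - (w - 1) / w / M%:R ^+ 2.
pose be := (w - 1) / w / M%:R + 2%:R / M%:R ^+ 2.
pose ga := (- (w - 1) ^+ 2 / w / 2%:R - (al + be) * w) / (w - 1).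
pose G (j : nat) : C := (al * j%:R ^+ 2 + be * j%:R + ga) * w ^+ j.
have step (j : nat) : (1 - w) * (1 - w^-1) * (kpoly (j%:R / M%:R) * w ^+ j) = G j.+1 - G j.
  rewrite /G /kpoly -natr1 [w ^+ j.+1]exprS /ga /be /al.
  field.
  by rewrite M_neq0 w0 w1.
have tot : (1 - w) * (1 - w^-1) * (\sum_(j < M) kpoly (j%:R / M%:R) * w ^+ j) = 2%:R / M%:R.
  rewrite mulr_sumr (eq_bigr (fun j : 'I_M => G j.+1 - G j)) => [|j _]; last exact: step.
  rewrite -(big_mkord xpredT (fun j => G j.+1 - G j)) telescope_sumr // /G wM expr0.
  rewrite /al /be; field.
  by rewrite M_neq0 w0.
have pos : 0 < (1 - w) * (1 - w^-1).
  have -> : (1 - w) * (1 - w^-1) = `|1 - w| ^+ 2.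
    by rewrite normCK rmorphB rmorph1 -norm1_conj.
  by rewrite exprn_gt0 // normr_gt0 -opprB oppr_eq0.
by rewrite -(pmulr_rge0 _ pos) tot divr_ge0.
Qed.

Lemma sum_kcoef : \sum_(k < M) kcoef k = 2^-1.
Proof.
have := kern_fourier 0 0; rewrite /kern subrr normr0 /kpoly subr0 expr0n addr0 => ->.
by apply: eq_bigr => k _; rewrite muln0 expr0 rmorph1 !mulr1.
Qed.

Section Divisible.
Variables (p q : nat) (p0 : (0 < p)%N) (q0 : (0 < q)%N).
Hypothesis MpQ : M = (p * q)%N.

(* Averaging over [t < p] the characters [k |-> zeta ^+ (k * q * t)] detects [p %| k]. *)
Lemma sum_kcoef_dvd : \sum_(k < M | (p %| k)%N) kcoef k =
  3%:R^-1 + (6%:R * p%:R ^+ 2)^-1.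
Proof.
have p_neq0 : p%:R != 0 :> C by rewrite pnatr_eq0 -lt0n.
have q_neq0 : q%:R != 0 :> C by rewrite pnatr_eq0 -lt0n.
transitivity (p%:R^-1 * \sum_(t < p) kern (t * q) 0).
  rewrite big_mkcond /=.
  under [in RHS]eq_bigr do rewrite kern_fourier.
  rewrite exchange_big mulr_sumr /=; apply: eq_bigr => k _.
  under eq_bigr do rewrite muln0 expr0 rmorph1 mulr1 mulnCA mulnC exprM.
  rewrite -mulr_sumr geom_unity; last first.
    by rewrite -exprM -mulnA (mulnC q) -MpQ mulnC exprM zetaM expr1n.
  have -> : (zeta ^+ (k * q) == 1) = (p %| k)%N.
    by rewrite -(prim_order_dvd zetaP) [X in (X %| _)%N = _]MpQ dvdn_pmul2r.
  by case: ifP => _; rewrite ?mulr0 // mulrCA mulVf // mulr1.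
rewrite (eq_bigr (fun t : 'I_p => kpoly (t%:R / p%:R : C))); last first.
  move=> t _; rewrite /kern mod0n mul0r subr0 modn_small; last by rewrite MpQ ltn_pmul2r.
  rewrite ger0_norm ?divr_ge0 // MpQ !natrM; congr kpoly; field.
  by rewrite p_neq0 q_neq0.
have tele (n : nat) : \sum_(t < n) kpoly (t%:R / p%:R : C) =
    n%:R / 2%:R - (n%:R * (n%:R - 1)) / 2%:R / p%:R
    + (n%:R * (n%:R - 1) * (2%:R * n%:R - 1)) / 6%:R / p%:R ^+ 2.
  elim: n => [|n IH]; first by rewrite big_ord0; ring.
  rewrite big_ord_recr /= IH -natr1 /kpoly; field.
  by rewrite p_neq0 ?pnatr_eq0.
rewrite tele; field.
by rewrite p_neq0 ?pnatr_eq0.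
Qed.

Variables (d N : nat) (y : 'I_N -> 'I_d -> nat) (b : nat).
Hypothesis expsum_bound : forall k : {ffun 'I_d -> 'I_M},
  (exists i, ~~ (p %| k i)%N) ->
  `|\sum_n zeta ^+ (\sum_i k i * y n i)%N| ^+ 2 <= b%:R.

Lemma sum_prod_kern : \sum_n \sum_m \prod_i kern (y n i) (y m i) <=
  (3%:R^-1 + (6%:R * p%:R ^+ 2)^-1) ^+ d * N%:R ^+ 2 + 2^-1 ^+ d * b%:R.
Proof.
pose S (k : {ffun 'I_d -> 'I_M}) := \sum_n zeta ^+ (\sum_i k i * y n i)%N.
pose W (k : {ffun 'I_d -> 'I_M}) := \prod_i kcoef (k i).
have W_ge0 k : 0 <= W k by apply: prodr_ge0 => i _; apply: kcoef_ge0.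
have -> : \sum_n \sum_m \prod_i kern (y n i) (y m i) = \sum_k W k * `|S k| ^+ 2.
  transitivity (\sum_n \sum_m \sum_k W k * (zeta ^+ (\sum_i k i * y n i)%N *
      (zeta ^+ (\sum_i k i * y m i)%N)^*)).
    apply: eq_bigr => n _; apply: eq_bigr => m _.
    under eq_bigr do rewrite kern_fourier.
    rewrite bigA_distr_bigA /=; apply: eq_bigr => k _.
    by rewrite big_split /= [X in _ * X = _]big_split /= !expr_sum rmorph_prod.
  rewrite (eq_bigr (fun n => \sum_k \sum_m W k * (zeta ^+ (\sum_i k i * y n i)%N *
      (zeta ^+ (\sum_i k i * y m i)%N)^*))) => [|n _]; last exact: exchange_big.
  rewrite exchange_big /=; apply: eq_bigr => k _.
  rewrite normCK rmorph_sum /= mulr_suml mulr_sumr; apply: eq_bigr => n _.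
  by rewrite !mulr_sumr.
pose div (k : {ffun 'I_d -> 'I_M}) := [forall i, (p %| k i)%N].
have cdv (F : 'I_M -> C) :
    (\sum_(k < M) F k) ^+ d = \sum_(k : {ffun 'I_d -> 'I_M}) \prod_i F (k i).
  by rewrite -(bigA_distr_bigA (fun=> F)) prodr_const card_ord.
(* Both d-th powers expand over the same k, so the comparison is termwise: a k with all entries
   divisible by p is charged to the first power, any other to the second, and the leftover terms are
   nonnegative. *)
rewrite -sum_kcoef_dvd -sum_kcoef [\sum_(k < M | (p %| k)%N) _]big_mkcond.
rewrite !cdv !mulr_suml -big_split /=.
apply: ler_sum => k _; rewrite -/(W k).
have [dk|ndk] := boolP (div k).
  rewrite (eq_bigr (fun i => kcoef (k i))) => [|i _]; last by rewrite (forallP dk i).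
  rewrite -/(W k) -[X in X <= _]addr0; apply: lerD; last by rewrite mulr_ge0.
  apply: ler_wpM2l => //; apply: lerXn2r; rewrite ?nnegrE // /S.
  apply: le_trans (ler_norm_sum _ _ _) _.
  under eq_bigr do rewrite normrX zeta_norm expr1n.
  by rewrite sumr_const card_ord.
rewrite -[X in X <= _]add0r; apply: lerD.
  rewrite mulr_ge0 ?exprn_ge0 //; apply: prodr_ge0 => i _; case: ifP => // _.
  exact: kcoef_ge0.
apply: ler_wpM2l => //; apply: expsum_bound.
by move: ndk; rewrite negb_forall => /existsP.
Qed.

End Divisible.

End Kernel.

(** * The exponential sums of the three point sets *)

Section ExpSums.
Variables (p : nat) (p_pr : prime p).

Lemma Fp_nat_eq0 n : (n%:R == 0 :> 'F_p) = (p %| n)%N.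
Proof. by rewrite -(dvdn_pcharf (pchar_Fp p_pr)). Qed.

Lemma root_count d (g : 'I_d -> nat) : (exists i, ~~ (p %| g i)%N) ->
  (\sum_(u < p) (p %| \sum_i g i * u ^ i) <= d.-1)%N.
Proof.
move=> [i0 gi0]; pose G : {poly 'F_p} := \sum_(i < d) (g i)%:R *: 'X^i.
have coefG (i : 'I_d) : G`_i = (g i)%:R.
  rewrite /G coef_sum (bigD1 i) //= coefZ coefXn eqxx mulr1 big1 ?addr0 // => j ji.
  by rewrite coefZ coefXn eq_sym (inj_eq val_inj) (negPf ji) mulr0.
have G0 : G != 0.
  by apply: contraNneq gi0 => G0; rewrite -Fp_nat_eq0 -coefG G0 coef0.
have sG : (size G <= d)%N.
  rewrite (leq_trans (size_sum _ _ _)) //; apply/bigmax_leqP => i _.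
  by rewrite (leq_trans (size_scale_leq _ _)) // size_polyXn.
rewrite -(big_mkord xpredT (fun u => nat_of_bool (p %| \sum_i g i * u ^ i)%N)).
rewrite sum_nat_bool; set us := [seq _ <- _ | _].
have := @max_poly_roots _ G [seq u%:R | u <- us] G0.
rewrite size_map => H; have : (size us < size G)%N.
  apply: H.
    apply/allP => x /mapP[u]; rewrite mem_filter => /andP[/= dv _] ->.
    rewrite rootE /G horner_sum; apply/eqP; rewrite -[RHS](_ : (\sum_i g i * u ^ i)%:R = 0).
      rewrite natr_sum; apply: eq_bigr => i _.
      by rewrite !hornerE natrM natrX.
    by apply/eqP; rewrite Fp_nat_eq0.
  rewrite map_inj_in_uniq ?filter_uniq ?iota_uniq // => u v.
  rewrite !mem_filter !mem_index_iota => /andP[_ /= up] /andP[_ /= vp].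
  move=> /(congr1 (@nat_of_ord _)); rewrite !val_Fp_nat //.
  by rewrite !modn_small.
lia.
Qed.

Variable C : numClosedFieldType.

Lemma expsum_le_roots (g : nat -> nat) (c : nat -> C) (w : C) e :
    p.-primitive_root w -> (forall u, `|c u| = 1) ->
    (\sum_(u < p) (p %| g u) <= e)%N ->
  `|\sum_(u < p) c u * \sum_(v < p) w ^+ (v * g u)| ^+ 2 <= (e ^ 2 * (p * p))%:R.
Proof.
move=> wP c1 le_e.
have le : `|\sum_(u < p) c u * \sum_(v < p) w ^+ (v * g u)| <= (e * p)%:R.
  apply: le_trans (ler_norm_sum _ _ _) _.
  rewrite (eq_bigr (fun u : 'I_p => (nat_of_bool (p %| g u)%N * p)%:R)); last first.
    move=> u _; rewrite normrM c1 mul1r.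
    under eq_bigr do rewrite mulnC exprM.
    rewrite geom_unity; last by rewrite -exprM mulnC exprM (prim_expr_order wP) expr1n.
    rewrite -(prim_order_dvd wP).
    by case: (p %| g u)%N; rewrite ?mul1n ?mul0n ?normr0 // normr_nat.
  by rewrite -natr_sum -big_distrl /= ler_nat leq_mul2r le_e orbT.
apply: le_trans (lerXn2r 2 _ _ le) _; rewrite ?nnegrE //.
by rewrite -natrX ler_nat expnMn mulnn.
Qed.

Lemma expsum_R d (k : 'I_d -> nat) (w : C) : p.-primitive_root w ->
    (exists i, ~~ (p %| k i)%N) ->
  `|\sum_(n < p * p) w ^+ (\sum_(i < d) k i * ((n %/ p) ^ i * (n %% p)))%N| ^+ 2
     <= (d.-1 ^ 2 * (p * p))%:R.
Proof.
move=> wP /root_count rc.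
rewrite (big_ord_mul p p (fun n => w ^+ (\sum_(i < d) k i * ((n %/ p) ^ i * (n %% p)))%N)).
rewrite [X in `|X|](_ : _ = \sum_(u < p) 1 *
    \sum_(v < p) w ^+ (v * (\sum_i k i * u ^ i))); last first.
  apply: eq_bigr => u _; rewrite mul1r; apply: eq_bigr => v _; congr (_ ^+ _).
  rewrite big_distrr /=; apply: eq_bigr => i _.
  by rewrite divnMDl ?prime_gt0 // divn_small // addn0 modnMDl modn_small // mulnA mulnC.
apply: (@expsum_le_roots (fun u => \sum_i k i * u ^ i)%N (fun=> 1) w) => // _.
exact: normr1.
Qed.

Lemma expn_split (u v i : nat) : exists t,
  ((v * p + u) ^ i.+1 = u ^ i.+1 + p * (v * (i.+1 * u ^ i)) + p * p * t)%N.
Proof.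
elim: i => [|i [t IH]]; first by exists 0%N; rewrite !expn1 expn0; ring.
exists (t * (v * p + u) + v * v * (i.+1 * u ^ i))%N.
by rewrite expnS IH !expnS; ring.
Qed.

(** With n = v p + u the phase modulo p^2 is its value at u plus p v times its derivative at u.
    Summing over v leaves the zeros of the derivative modulo p, whose coefficients k_i (i + 1) are
    not all divisible by p because i + 1 <= d < p. *)
Lemma expsum_Q d (k : 'I_d -> nat) (z : C) : (d < p)%N ->
    (p * p).-primitive_root z -> (exists i, ~~ (p %| k i)%N) ->
  `|\sum_(n < p * p) z ^+ (\sum_(i < d) k i * n ^ i.+1)%N| ^+ 2
     <= (d.-1 ^ 2 * (p * p))%:R.
Proof.
move=> dp zP [i0 ki0]; have p0 := prime_gt0 p_pr.
have wP : p.-primitive_root (z ^+ p).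
  by have := exp_prim_root zP p; rewrite (gcdn_idPl (dvdn_mulr p (dvdnn p))) mulnK.
have zpp : z ^+ (p * p) = 1 by apply: prim_expr_order.
have rc : (\sum_(u < p) (p %| \sum_i (k i * i.+1) * u ^ i) <= d.-1)%N.
  apply: root_count; exists i0; rewrite Euclid_dvdM // negb_or ki0 gtnNdvd //.
  exact: leq_ltn_trans (ltn_ord i0) dp.
rewrite (big_ord_mul p p (fun n => z ^+ (\sum_(i < d) k i * n ^ i.+1)%N)).
rewrite exchange_big /= [X in `|X|](_ : _ = \sum_(u < p) z ^+ (\sum_i k i * u ^ i.+1)%N *
    \sum_(v < p) (z ^+ p) ^+ (v * (\sum_i (k i * i.+1) * u ^ i))); last first.
  apply: eq_bigr => u _; rewrite mulr_sumr; apply: eq_bigr => v _.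
  rewrite big_distrr /= !expr_sum -big_split /=; apply: eq_bigr => i _.
  have [t ->] := expn_split u v i.
  rewrite [(_ * (_ + _ + _))%N](_ : _ = k i * u ^ i.+1 + p * (v * (k i * i.+1 * u ^ i))
     + p * p * (k i * t))%N; last by ring.
  by rewrite !exprD !exprM -(exprM z p p) zpp !expr1n mulr1 -!exprM.
apply: (@expsum_le_roots (fun u => \sum_i (k i * i.+1) * u ^ i)%N
  (fun u => z ^+ (\sum_i k i * u ^ i.+1)%N)) => // u.
by rewrite normrX (unity_norm _ zpp) ?muln_gt0 ?p0 // expr1n.
Qed.

Hypothesis archC : forall x : C, 0 <= x -> exists n, x < n%:R.

Lemma expsum_P d (k : 'I_d -> nat) (z : C) : (d < p)%N ->
    p.-primitive_root z -> (exists i, ~~ (p %| k i)%N) ->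
  `|\sum_(n < p) z ^+ (\sum_(i < d) k i * n ^ i.+1)%N| ^+ 2 <= (d.-1 ^ 2 * p)%:R.
Proof.
move=> dp zP [i0 ki0]; have p0 := prime_gt0 p_pr.
have zn : `|z| = 1 by rewrite (unity_norm p0) // prim_expr_order.
pose psi (a : 'F_p) := z ^+ (a : nat).
have psi_nat n : psi n%:R = z ^+ n by rewrite /psi val_Fp_nat // prim_expr_mod.
have psiD a b : psi (a + b) = psi a * psi b.
  by rewrite -(natr_Zp a) -(natr_Zp b) -natrD !psi_nat exprD.
have psi0 : psi 0 = 1 by [].
have psi_neq1 a : a != 0 -> psi a != 1.
  rewrite -(natr_Zp a) psi_nat => a0.
  by rewrite -(prim_order_dvd zP) -Fp_nat_eq0.
have psi_norm a : `|psi a| = 1 by rewrite normrX zn expr1n.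
pose f : {poly 'F_p} := \sum_(i < d) (k i)%:R *: 'X^(i.+1).
have f_coef (i : 'I_d) : f`_i.+1 = (k i)%:R.
  rewrite coef_sum (bigD1 i) //= coefZ coefXn eqxx mulr1 big1 ?addr0 // => j ji.
  by rewrite coefZ coefXn eqSS eq_sym (inj_eq val_inj) (negPf ji) mulr0.
have f0 : f != 0.
  by apply: contraNneq ki0 => f0; rewrite -Fp_nat_eq0 -f_coef f0 coef0.
have f00 : f`_0 = 0.
  by rewrite coef_sum big1 // => j _; rewrite coefZ coefXn mulr0.
have sf_le : (size f <= d.+1)%N.
  rewrite (leq_trans (size_sum _ _ _)) //; apply/bigmax_leqP => i _.
  by rewrite (leq_trans (size_scale_leq _ _)) // size_polyXn ltnS.
have sf_gt1 : (1 < size f)%N.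
  rewrite ltnNge; apply/negP => /size1_polyC fE.
  by move: f0; rewrite fE f00 polyC0 eqxx.
have fE : \sum_(n < p) z ^+ (\sum_(i < d) k i * n ^ i.+1)%N = \sum_(x : 'F_p) psi f.[x].
  pose F n := z ^+ (\sum_(i < d) k i * n ^ i.+1)%N.
  rewrite -(big_mkord xpredT F) -[X in index_iota 0 X](Fp_cast p_pr) big_mkord; apply: eq_bigr => x _.
  rewrite /F -psi_nat natr_sum /f horner_sum; congr psi; apply: eq_bigr => i _.
  by rewrite !hornerE natrM natrX natr_Zp.
(* The top coefficients may vanish modulo p, so Weil's bound is applied with the true degree D <= d;
   D > 0 because f is nonzero without constant term. *)
have [D sD] : exists D, size f = D.+1 by exists (size f).-1; lia.
have D0 : (0 < D)%N by lia.
have Dd : (D <= d)%N by lia.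
have := weil_bound archC p_pr psiD psi0 psi_neq1 psi_norm D0 (leq_ltn_trans Dd dp) sD.
rewrite fE => /le_trans; apply; rewrite ler_nat leq_mul2r leq_exp2r //.
by apply/orP; right; lia.
Qed.

End ExpSums.

(** * The iterated integral *)

Section IteratedIntegral.
Local Open Scope classical_set_scope.
Variable R : realType.
Notation mu := (@lebesgue_measure R).
Notation I01 := (`[0, 1]%classic : set R).

Definition has_int (f : R -> R) (v : R) : Prop :=
  mu.-integrable I01 (EFin \o f) /\ (\int[mu]_(t in I01) (f t)%:E)%E = v%:E.

Lemma has_int_ext f g v : (forall t, 0 <= t <= 1 -> f t = g t) ->
  has_int f v -> has_int g v.
Proof.
move=> fg [fi fv]; split.
  apply: eq_integrable fi => //= t.
  by rewrite inE /= in_itv /= => t01; rewrite fg.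
by rewrite -fv; apply: eq_integral => t; rewrite inE /= in_itv /= => t01; rewrite fg.
Qed.

Lemma has_int_eq f v w : has_int f v -> v = w -> has_int f w.
Proof. by move=> h <-. Qed.

Lemma has_intD f g v w : has_int f v -> has_int g w ->
  has_int (fun t => f t + g t) (v + w).
Proof.
move=> [fi fv] [gi gw]; split.
  by apply: (eq_integrable _ _ _ _ (integrableD _ fi gi)).
by rewrite EFinD -fv -gw -integralD_EFin.
Qed.

Lemma has_intZ k f v : has_int f v -> has_int (fun t => k * f t) (k * v).
Proof.
move=> [fi fv]; split.
  by apply: (eq_integrable _ _ _ _ (integrableZl _ k fi)).
by rewrite EFinM -fv -integralZl.
Qed.

(** Both kinds of ray occur because I(x, y) is half-open: for fixed x the wrap-around ends once
    [x <= y], while a point z is passed only when [z < y]. *)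
Definition step (c : bool) (a t : R) : R := (if c then a <= t else a < t)%:R.

Lemma has_int_step (c : bool) (m : nat) (a : R) : 0 <= a <= 1 ->
  has_int (fun t => t ^+ m * step c a t) ((1 - a ^+ m.+1) / m.+1%:R).
Proof.
move=> /andP[a0 a1].
pose S : set R := [set` Interval (BSide c a) (BRight 1)].
pose g (t : R) := (t ^+ m)%:E.
have mS : measurable S by exact: measurable_itv.
have fE t : t \in I01 -> (t ^+ m * step c a t)%:E = (g \_ S) t.
  rewrite inE /= in_itv /= => /andP[t0 t1]; rewrite patchE /step /g /S.
  have -> : (t \in S) = (if c then a <= t else a < t).
    by apply/idP/idP; rewrite inE /S /= in_itv /= t1 andbT; case: c {S mS}.
  by case: (if c then _ else _); rewrite ?mulr1 ?mulr0.
have SI : I01 `&` S = S.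
  apply/setIidr => t; rewrite /S /= !in_itv /= => /andP[h t1].
  by rewrite t1 andbT (le_trans a0) //; case: c h {S mS fE} => //; exact: ltW.
have cg : continuous (fun t : R => t ^+ m) by exact: exprn_continuous.
have gi : mu.-integrable I01 g.
  apply: continuous_compact_integrable; first exact: segment_compact.
  exact: continuous_subspaceT.
split.
  have gSi : mu.-integrable I01 (g \_ S).
    apply/integrable_restrict => //; rewrite SI.
    by apply: integrableS gi => //; rewrite -SI; exact: subIsetl.
  by apply: (eq_integrable _ _ _ _ gSi) => // t t01; rewrite /= fE.
transitivity (\int[mu]_(t in I01) (g \_ S) t)%E.
  by apply: eq_integral => t t01; rewrite fE.
rewrite -integral_mkcondr SI.
have -> : (\int[mu]_(t in S) g t = \int[mu]_(t in `[a, 1%R]) g t)%E.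
  rewrite /S; case: (c) => //; rewrite integral_itv_obnd_cbnd //.
  have /integrableP[mg _] := gi.
  apply: measurable_funS mg => // t /=; rewrite !in_itv /= => /andP[at_ ->].
  by rewrite andbT (le_trans a0) // ltW.
move: a1; rewrite le_eqVlt => /predU1P[->|a1].
  by rewrite set_itv1 integral_set1 expr1n subrr mul0r.
rewrite (@continuous_FTC2 _ _ (fun t => t ^+ m.+1 / m.+1%:R)) //.
- by rewrite expr1n -EFinB -mulrBl.
- exact: continuous_subspaceT.
- split.
  + by move=> t _; apply: derivableM => //; exact: exprn_derivable.
  + apply: cvg_at_right_filter; apply: cvgM; last exact: cvg_cst.
    exact: exprn_continuous.
  + apply: cvg_at_left_filter; apply: cvgM; last exact: cvg_cst.
    exact: exprn_continuous.
- move=> t _; rewrite derive1Mr; last exact: exprn_derivable.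
  rewrite derive1E exp_derive /GRing.scale /= mulr1 mulrAC -mulr_natl.
  by rewrite mulfV // mul1r.
Qed.

Definition quad (c0 c1 c2 t : R) : R := c0 + c1 * t + c2 * t ^+ 2.

Lemma has_int_quad c a c0 c1 c2 : 0 <= a <= 1 ->
  has_int (fun t => quad c0 c1 c2 t * step c a t)
    (c0 * (1 - a) + c1 * ((1 - a ^+ 2) / 2) + c2 * ((1 - a ^+ 3) / 3)).
Proof.
move=> a01.
have h0 := has_intZ c0 (has_int_step c 0 a01).
have h1 := has_intZ c1 (has_int_step c 1 a01).
have h2 := has_intZ c2 (has_int_step c 2 a01).
apply: has_int_eq (has_int_ext _ (has_intD (has_intD h0 h1) h2)) _.
  by move=> t _; rewrite /quad expr0 expr1; ring.
by rewrite expr1 divr1.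
Qed.

(* [F] has iterated integral [v], with integrability at every stage. *)
Fixpoint iter_int (n : nat) (F : seq R -> R) (v : R) : Prop :=
  match n with
  | 0 => F [::] = v
  | n'.+1 => exists G : R -> R,
      (forall t, 0 <= t <= 1 -> iter_int n' (fun s => F (t :: s)) (G t)) /\ has_int G v
  end.

Definition in01 (s : seq R) := all (fun t => 0 <= t <= 1) s.

Lemma iter_int_ext n F F' v :
  (forall s, size s = n -> in01 s -> F s = F' s) -> iter_int n F v -> iter_int n F' v.
Proof.
elim: n F F' v => [|n IH] F F' v e /=; first by rewrite -e.
move=> [G [h1 h2]]; exists G; split=> // t t01; apply: IH (h1 t t01) => s ss s01.
by apply: e; rewrite /= ?ss ?t01.
Qed.

Lemma iter_intD n F F' v v' : iter_int n F v -> iter_int n F' v' ->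
  iter_int n (fun s => F s + F' s) (v + v').
Proof.
elim: n F F' v v' => [|n IH] F F' v v' /=; first by move=> -> ->.
move=> [G [h1 h2]] [G' [h1' h2']]; exists (fun t => G t + G' t); split.
  by move=> t t01; apply: IH; [exact: h1|exact: h1'].
exact: has_intD.
Qed.

Lemma iter_intZ n k F v : iter_int n F v -> iter_int n (fun s => k * F s) (k * v).
Proof.
elim: n F v => [|n IH] F v /=; first by move=> ->.
move=> [G [h1 h2]]; exists (fun t => k * G t); split; last exact: has_intZ.
by move=> t t01; apply: IH; exact: h1.
Qed.

Lemma iter_int0 n : iter_int n (fun=> 0) 0.
Proof.
elim: n => //= n IH; exists (fun=> 0); split => //; split; first exact: integrable0.
by rewrite integral0.
Qed.

Lemma iter_int_sum n (T : Type) (r : seq T) F v : (forall i, iter_int n (F i) (v i)) ->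
  iter_int n (fun s => \sum_(i <- r) F i s) (\sum_(i <- r) v i).
Proof.
move=> h; elim: r => [|i r IH].
  by rewrite big_nil; apply: iter_int_ext (iter_int0 n) => s _ _; rewrite big_nil.
rewrite big_cons; apply: iter_int_ext (iter_intD (h i) IH) => s _ _.
by rewrite big_cons.
Qed.

Lemma iter_int_prod n (psi : nat -> R -> R) v : (forall i, has_int (psi i) (v i)) ->
  iter_int n (fun s => \prod_(i < n) psi i (nth 0 s i)) (\prod_(i < n) v i).
Proof.
elim: n psi v => [|n IH] psi v h /=; first by rewrite !big_ord0.
exists (fun t => (\prod_(i < n) v i.+1) * psi 0%N t); split; last first.
  by rewrite big_ord_recl mulrC; apply: has_intZ.
move=> t t01; rewrite mulrC.
have := iter_intZ (psi 0%N t) (IH (fun i => psi i.+1) (fun i => v i.+1) (fun i => h i.+1)).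
by apply: iter_int_ext => s _ _; rewrite big_ord_recl.
Qed.

Lemma iter_int_cat n m F G v :
    (forall s, size s = n -> in01 s -> iter_int m (fun s' => F (s ++ s')) (G s)) ->
  iter_int n G v -> iter_int (n + m) F v.
Proof.
elim: n F G v => [|n IH] F G v h /=; first by move=> <-; exact: (h [::]).
move=> [G' [h1 h2]]; exists G'; split=> // t t01.
by apply: IH (h1 t t01) => s ss s01; apply: (h (t :: s)); rewrite /= ?ss ?t01.
Qed.

Lemma iter_int_iint n F v : iter_int n F v -> iint n (fun s => (F s)%:E) = v%:E.
Proof.
elim: n F v => [|n IH] F v /=; first by move=> ->.
move=> [G [h1 [_ <-]]]; apply: eq_integral => t; rewrite inE /= in_itv /= => t01.
exact/IH/h1.
Qed.

Ltac cmp_solve := rewrite ?mulr1 ?mulr0 ?mul1r ?mul0r ?addr0 ?add0r;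
  first [by [] | ring | (exfalso; lra) | lra].

(* In the names below [p] stands for the indicator of a point lying in [I(x, y)] and
   [l] for the length of [I(x, y)]; [phi_pp] and [phi_pl] are the integrals over [y]. *)
Definition phi_pp (z z' x : R) : R :=
  quad (1 - z) 1 0 x * step true 0 x + quad (- (1 - z + z')) 0 0 x * step false z' x
  + quad (z' - z) 0 0 x * step false z x.

Lemma int_y_pp (x z z' : R) : 0 <= x <= 1 -> 0 <= z' -> z' <= z -> z <= 1 ->
  has_int (fun y => (inI x y z)%:R * (inI x y z')%:R) (phi_pp z z' x).
Proof.
move=> /andP[x0 x1] z'0 z'z z1.
have q01 : 0 <= (0 : R) <= 1 by rewrite lexx ler01.
have qx : 0 <= x <= 1 by rewrite x0.
have qz : 0 <= z <= 1 by rewrite (le_trans z'0).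
have qz' : 0 <= z' <= 1 by rewrite z'0 (le_trans z'z).
have c c0 c1 c2 := has_int_quad true c0 c1 c2 q01.
have hx c0 c1 c2 := has_int_quad true c0 c1 c2 qx.
have hz c0 c1 c2 := has_int_quad false c0 c1 c2 qz.
have hz' c0 c1 c2 := has_int_quad false c0 c1 c2 qz'.
rewrite /phi_pp /step x0.
have [xz'|xz'] := leP x z'.
  have xz := le_trans xz' z'z; rewrite ltNge xz /=.
  apply: has_int_eq (has_int_ext _
    (has_intD (has_intD (c 1 0 0) (hx (- 1) 0 0)) (hz 1 0 0))) _.
    move=> y /andP[y0 y1]; rewrite /inI /step /quad y0 xz xz'.
    by case: (leP x y) => ?; case: (ltP z y) => ?; case: (ltP z' y) => ? /=; cmp_solve.
  by rewrite /quad /=; ring.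
have [xz|xz] := leP x z.
  apply: has_int_eq (has_int_ext _ (has_intD (hx (- 1) 0 0) (hz' 1 0 0))) _.
    move=> y /andP[y0 y1]; rewrite /inI /step /quad xz [x <= z']leNgt xz'.
    by case: (leP x y) => ?; case: (ltP z y) => ?; case: (ltP z' y) => ? /=; cmp_solve.
  by rewrite /quad /=; ring.
apply: has_int_eq (has_int_ext _ (has_intD (hx (- 1) 0 0) (hz 1 0 0))) _.
  move=> y /andP[y0 y1]; rewrite /inI /step /quad [x <= z']leNgt xz' [x <= z]leNgt xz.
  by case: (leP x y) => ?; case: (ltP z y) => ?; case: (ltP z' y) => ? /=; cmp_solve.
by rewrite /quad /=; ring.
Qed.

Lemma int_x_pp (z z' : R) : 0 <= z' -> z' <= z -> z <= 1 ->
  has_int (phi_pp z z') (kpoly (z - z')).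
Proof.
move=> z'0 z'z z1.
have q01 : 0 <= (0 : R) <= 1 by rewrite lexx ler01.
have qz : 0 <= z <= 1 by rewrite (le_trans z'0).
have qz' : 0 <= z' <= 1 by rewrite z'0 (le_trans z'z).
apply: has_int_eq (has_intD (has_intD (has_int_quad true _ _ _ q01)
  (has_int_quad false _ _ _ qz')) (has_int_quad false _ _ _ qz)) _.
by rewrite /kpoly; field.
Qed.

Definition phi_pl (z x : R) : R :=
  quad ((1 - z ^+ 2) / 2) z (- 2^-1) x * step true 0 x +
  quad (- z - 2^-1) 1 0 x * step false z x.

Lemma int_y_pl (x z : R) : 0 <= x <= 1 -> 0 <= z <= 1 ->
  has_int (fun y => (inI x y z)%:R * lenI x y) (phi_pl z x).
Proof.
move=> qx qz; have /andP[x0 x1] := qx; have /andP[z0 z1] := qz.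
have q01 : 0 <= (0 : R) <= 1 by rewrite lexx ler01.
have c c0 c1 c2 := has_int_quad true c0 c1 c2 q01.
have hx c0 c1 c2 := has_int_quad true c0 c1 c2 qx.
have hz c0 c1 c2 := has_int_quad false c0 c1 c2 qz.
rewrite /phi_pl /step x0.
have [xz|xz] := leP x z.
  apply: has_int_eq (has_int_ext _
    (has_intD (has_intD (c (1 - x) 1 0) (hx (x - 1) (- 1) 0)) (hz (- x) 1 0))) _.
    move=> y /andP[y0 y1]; rewrite /inI /lenI /step /quad y0 xz.
    by case: (leP x y) => ?; case: (ltP z y) => ? /=; cmp_solve.
  by rewrite /quad /=; field.
apply: has_int_eq (has_int_ext _ (has_intD (hx (x - 1) (- 1) 0) (hz (1 - x) 1 0))) _.
  move=> y /andP[y0 y1]; rewrite /inI /lenI /step /quad [x <= z]leNgt xz.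
  by case: (leP x y) => ?; case: (ltP z y) => ? /=; cmp_solve.
by rewrite /quad /=; field.
Qed.

Lemma int_x_pl (z : R) : 0 <= z <= 1 -> has_int (phi_pl z) 3^-1.
Proof.
move=> qz; have q01 : 0 <= (0 : R) <= 1 by rewrite lexx ler01.
apply: has_int_eq (has_intD (has_int_quad true _ _ _ q01)
  (has_int_quad false _ _ _ qz)) _.
by field.
Qed.

Lemma int_y_ll (x : R) : 0 <= x <= 1 -> has_int (fun y => lenI x y * lenI x y) 3^-1.
Proof.
move=> qx; have q01 : 0 <= (0 : R) <= 1 by rewrite lexx ler01.
apply: has_int_eq (has_int_ext _ (has_intD
   (has_int_quad true ((1 - x) ^+ 2) (2 * (1 - x)) 1 q01)
   (has_int_quad true (2 * x - 1) (- 2) 0 qx))) _.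
  move=> y /andP[y0 y1]; rewrite /lenI /step /quad y0.
  by case: (leP x y) => ? /=; cmp_solve.
by field.
Qed.

Lemma int_x_ll : has_int (fun=> 3^-1) 3^-1.
Proof.
have q01 : 0 <= (0 : R) <= 1 by rewrite lexx ler01.
apply: has_int_eq (has_int_ext _ (has_int_quad true 3^-1 0 0 q01)) _.
  by move=> x /andP[x0 _]; rewrite /quad /step x0 /=; ring.
by ring.
Qed.

Lemma int_pp (z z' : R) : 0 <= z <= 1 -> 0 <= z' <= 1 -> exists Phi : R -> R,
  (forall x, 0 <= x <= 1 ->
     has_int (fun y => (inI x y z)%:R * (inI x y z')%:R) (Phi x)) /\
  has_int Phi (kpoly `|z - z'|).
Proof.
move=> /andP[z0 z1] /andP[z'0 z'1]; have [zz'|zz'] := leP z' z.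
  exists (phi_pp z z'); split=> [x x01|]; first exact: int_y_pp.
  by rewrite ger0_norm ?subr_ge0 //; exact: int_x_pp.
exists (phi_pp z' z); split=> [x x01|].
  apply: has_int_ext (int_y_pp x01 z0 (ltW zz') z'1) => y _.
  by rewrite mulrC.
by rewrite ltr0_norm ?subr_lt0 // opprB; apply: int_x_pp => //; exact: ltW.
Qed.

(** * The squared discrepancy as a double sum of kernels *)

Section Boxes.
Variable d : nat.

Lemma iter_int_pairs (phi : nat -> R -> R -> R) (Phi : nat -> R -> R) (v : nat -> R) :
    (forall i x, 0 <= x <= 1 -> has_int (phi i x) (Phi i x)) ->
    (forall i, has_int (Phi i) (v i)) ->
  iter_int (d + d) (fun s => \prod_(i < d) phi i (nth 0 s i) (nth 0 s (d + i)))
    (\prod_(i < d) v i).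
Proof.
move=> h1 h2.
apply: (@iter_int_cat _ _ _ (fun s => \prod_(i < d) Phi i (nth 0 s i))); last first.
  exact: iter_int_prod.
move=> s ss s01.
have in01 i : 0 <= nth 0 s i <= 1.
  have [lti|lei] := ltnP i (size s); first by have /allP := s01; apply; exact: mem_nth.
  by rewrite nth_default // lexx ler01.
apply: iter_int_ext (iter_int_prod d (fun i => h1 i _ (in01 i))) => s' _ _.
apply: eq_bigr => i _; rewrite !nth_cat ss ltn_ord.
by rewrite ltnNge leq_addr /= addKn.
Qed.

Variables (N : nat) (X : nat -> nat -> R).
Hypothesis N0 : (0 < N)%N.
Hypothesis X01 : forall n i, 0 <= X n i <= 1.

Lemma inBE (x y z : nat -> R) :
  (inB d x y z)%:R = \prod_(i < d) (inI (x i) (y i) (z i))%:R :> R.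
Proof.
rewrite /inB; case: forallP => [h|h].
  by rewrite big1 // => i _; rewrite h.
have /existsP[i ni] : [exists i : 'I_d, ~~ inI (x i) (y i) (z i)].
  by rewrite -negb_forall; apply/negP => /forallP.
by rewrite (bigD1 i) //= (negPf ni) mul0r.
Qed.

(** The expanded square consists of products over coordinates. The integral of indicator times
    length is 1/3 per coordinate wherever the point lies, so the cross term gives -2 3^-d, the
    squared volume gives 3^-d, and the double sum over points gives the kernels. *)
Lemma L2per_sqE : L2per_sq d N X =
  ((\sum_(n < N) \sum_(m < N) \prod_(i < d) kpoly `|X n i - X m i|) / N%:R ^+ 2
    - (3^-1) ^+ d)%:E.
Proof.
have Nn0 : N%:R != 0 :> R by rewrite pnatr_eq0 -lt0n.
apply: iter_int_iint.
pose x (s : seq R) i := nth 0 s i.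
pose y (s : seq R) i := nth 0 s (d + i).
have pp (n m : 'I_N) : iter_int (d + d) (fun s =>
    \prod_(i < d) ((inI (x s i) (y s i) (X n i))%:R * (inI (x s i) (y s i) (X m i))%:R))
    (\prod_(i < d) kpoly `|X n i - X m i|).
  have [Phi hPhi] := choice (fun i => int_pp (X01 n i) (X01 m i)).
  apply: (@iter_int_pairs (fun i a b => (inI a b (X n i))%:R * (inI a b (X m i))%:R) Phi
     (fun i => kpoly `|X n i - X m i|)).
    by move=> i t t01; apply: (hPhi i).1.
  by move=> i; apply: (hPhi i).2.
have pl (n : 'I_N) : iter_int (d + d) (fun s =>
    \prod_(i < d) ((inI (x s i) (y s i) (X n i))%:R * lenI (x s i) (y s i)))
    (\prod_(i < d) 3^-1).
  apply: (@iter_int_pairs (fun i a b => (inI a b (X n i))%:R * lenI a b)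
     (fun i => phi_pl (X n i)) (fun=> 3^-1)).
    by move=> i t t01; apply: int_y_pl.
  by move=> i; apply: int_x_pl.
have ll : iter_int (d + d) (fun s =>
    \prod_(i < d) (lenI (x s i) (y s i) * lenI (x s i) (y s i))) (\prod_(i < d) 3^-1).
  apply: (@iter_int_pairs (fun i a b => lenI a b * lenI a b) (fun=> fun=> 3^-1) (fun=> 3^-1)).
    by move=> i t t01; apply: int_y_ll.
  by move=> i; apply: int_x_ll.
have H := iter_intD (iter_intD
  (iter_intZ (N%:R ^- 2) (iter_int_sum (index_enum 'I_N)
     (fun n => iter_int_sum (index_enum 'I_N) (fun m => pp n m))))
  (iter_intZ (- 2 / N%:R) (iter_int_sum (index_enum 'I_N) pl))) ll.
rewrite [X in iter_int _ _ X](_ : _ = N%:R ^- 2 *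
    (\sum_(n < N) \sum_(m < N) \prod_(i < d) kpoly `|X n i - X m i|) +
    - 2 / N%:R * \sum_(n < N) \prod_(i < d) 3^-1 + \prod_(i < d) 3^-1); last first.
  by rewrite !prodr_const sumr_const !card_ord -mulr_natl; field.
apply: iter_int_ext H => s _ _.
rewrite /local_disc /volB.
have -> : \sum_(n < N) (inB d (fun i => nth 0 s i) (fun i => nth 0 s (d + i)) (X n))%:R =
    \sum_(n < N) \prod_(i < d) (inI (x s i) (y s i) (X n i))%:R :> R.
  by apply: eq_bigr => n _; rewrite inBE.
set V := \prod_(i < d) lenI _ _.
rewrite (eq_bigr (fun n : 'I_N => \prod_(i < d) (inI (x s i) (y s i) (X n i))%:R *
   \sum_(m < N) \prod_(i < d) (inI (x s i) (y s i) (X m i))%:R)); last first.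
  move=> n _; rewrite mulr_sumr; apply: eq_bigr => m _; exact: big_split.
rewrite -mulr_suml.
rewrite [X in _ + _ * X + _ = _](eq_bigr (fun n : 'I_N =>
   \prod_(i < d) (inI (x s i) (y s i) (X n i))%:R * V)); last first.
  move=> n _; exact: big_split.
rewrite -mulr_suml big_split -/V /=.
by field.
Qed.

End Boxes.

End IteratedIntegral.

(** * The discrepancy bound *)

Section Assembly.
Variable R : realType.
Local Notation "x %:C" := (real_complex R x) (at level 1).

Lemma complex_arch (x : R[i]) : 0 <= x -> exists n, x < n%:R.
Proof.
case: x => a b; rewrite lecE /= => /andP[/eqP -> a0].
exists (Num.truncn a).+1; rewrite -(rmorph_nat (real_complex R)) ltcR.
by rewrite truncnS_gt.
Qed.

Lemma norm_realC (x : R) : `|x%:C| = `|x|%:C.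
Proof.
have [x0|x0] := leP 0 x; first by rewrite !ger0_norm // lecR.
by rewrite !ltr0_norm ?ltcR // rmorphN.
Qed.

Lemma closed_prim_root (C : numClosedFieldType) n : (0 < n)%N ->
  exists z : C, n.-primitive_root z.
Proof.
move=> n0; pose rs := closed_roots ('X^n - 1 : {poly C}).
have rsE : 'X^n - 1 = \prod_(z <- rs) ('X - z%:P).
  by apply: closed_rootsE; exact: monicXnsubC.
have nC0 : n%:R != 0 :> C by rewrite pnatr_eq0 -lt0n.
suff : has n.-primitive_root rs by move=> /hasP[z _ zP]; exists z.
apply: has_prim_root => //.
- by apply/allP => z; rewrite -root_prod_XsubC -rsE.
- by rewrite -separable_prod_XsubC -rsE separable_Xn_sub_1.
by rewrite -ltnS -(size_prod_XsubC _ id) -rsE size_XnsubC.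
Qed.

Lemma frac_div (a M : nat) : (0 < M)%N ->
  Defs.frac (a%:R / M%:R : R) = (a %% M)%:R / M%:R.
Proof.
move=> M0; have Mn0 : M%:R != 0 :> R by rewrite pnatr_eq0 -lt0n.
have Mp : 0 < M%:R :> R by rewrite ltr0n.
have aE : a%:R / M%:R = (a %/ M)%:R + (a %% M)%:R / M%:R :> R.
  by rewrite {1}(divn_eq a M) natrD natrM mulrDl mulfK.
rewrite /Defs.frac (@floor_def _ _ (Posz (a %/ M))).
  by rewrite aE addrAC subrr add0r.
rewrite aE lerDl divr_ge0 //= rmorphD /= ltrD2l ltr_pdivrMr // mul1r ltr_nat.
by rewrite ltn_mod.
Qed.

Lemma frac_div01 (a M : nat) : (0 < M)%N -> 0 <= Defs.frac (a%:R / M%:R : R) <= 1.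
Proof.
move=> M0; rewrite frac_div // divr_ge0 //= ler_pdivrMr ?ltr0n // mul1r ler_nat.
by rewrite ltnW // ltn_mod.
Qed.

Lemma kpoly_01 (u : R) : 0 <= u <= 1 -> 0 <= kpoly u <= 2^-1.
Proof.
move=> /andP[u0 u1]; rewrite /kpoly; apply/andP; split; last by nra.
have := sqr_ge0 (u - 2^-1); rewrite sqrrB; lra.
Qed.

(** The mean value bound d (a - b) 2^(1-d), written without the exponent d - 1 so that the induction
    can start at d = 0. *)
Lemma subX_le (a b : R) d : 0 <= b -> b <= a -> a <= 2^-1 ->
  a ^+ d - b ^+ d <= 2 * d%:R * (a - b) * 2^-1 ^+ d.
Proof.
move=> b0 ba a2; elim: d => [|d IH].
  by rewrite !expr0 subrr mulr0 !mul0r.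
have -> : a ^+ d.+1 - b ^+ d.+1 = a * (a ^+ d - b ^+ d) + (a - b) * b ^+ d.
  by rewrite !exprS; ring.
have h1 : a * (a ^+ d - b ^+ d) <= 2^-1 * (2 * d%:R * (a - b) * 2^-1 ^+ d).
  apply: ler_pM => //; first exact: le_trans ba.
  by rewrite subr_ge0 lerXn2r ?nnegrE // (le_trans b0).
have h2 : (a - b) * b ^+ d <= (a - b) * 2^-1 ^+ d.
  by rewrite ler_wpM2l ?subr_ge0 // lerXn2r ?nnegrE // (le_trans ba).
apply: le_trans (lerD h1 h2) _.
by rewrite le_eqVlt; apply/orP; left; apply/eqP; rewrite -natr1 exprS; field.
Qed.

Section Bound.
Variables (p q d N : nat) (y : nat -> nat -> nat).
Hypotheses (p_pr : prime p) (q0 : (0 < q)%N) (N0 : (0 < N)%N) (Np : (N <= p ^ 2)%N).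
Let M := (p * q)%N.
(** The premise [d ^ 2 < N] is available because smaller N fall to the trivial bound; with
    [N <= p ^ 2] it yields d < p. Denominators are p q, with q = p for the second point set and q =
    1 for the others. *)
Hypothesis expsum : forall (zeta : R[i]) (k : 'I_d -> nat),
  (d ^ 2 < N)%N -> M.-primitive_root zeta -> (exists i, ~~ (p %| k i)%N) ->
  `|\sum_(n < N) zeta ^+ (\sum_(i < d) k i * y n i)%N| ^+ 2 <= (d.-1 ^ 2 * N)%:R.
Let X n i : R := Defs.frac ((y n i)%:R / M%:R).

Let M0 : (0 < M)%N. Proof. by rewrite muln_gt0 prime_gt0. Qed.

Lemma kern_kpoly n m i :
  kern R[i] M (y n i) (y m i) = (kpoly `|X n i - X m i|)%:C.
Proof.
rewrite /kern /X !frac_div // -!(rmorph_nat (real_complex R)) -!fmorph_div /=.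
rewrite -rmorphB norm_realC /kpoly rmorphD rmorphB rmorphXn /= fmorphV.
by rewrite rmorph_nat.
Qed.

Let K := \sum_(n < N) \sum_(m < N) \prod_(i < d) kpoly `|X n i - X m i|.

Lemma K_trivial : K <= N%:R ^+ 2 * 2^-1 ^+ d.
Proof.
apply: (@le_trans _ _ (\sum_(n < N) \sum_(m < N) 2^-1 ^+ d)); last first.
  by rewrite !sumr_const !card_ord -mulrnA -[X in X <= _]mulr_natl natrM expr2.
apply: ler_sum => n _; apply: ler_sum => m _.
rewrite -[d in X in _ <= X](card_ord d) -prodr_const; apply: ler_prod => i _.
apply: kpoly_01; rewrite normr_ge0 /=.
have /andP[? ?] := frac_div01 (y n i) M0; have /andP[? ?] := frac_div01 (y m i) M0.
by rewrite ler_norml; apply/andP; split; rewrite /X; lra.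
Qed.

Lemma K_fourier : (d ^ 2 < N)%N ->
  K <= (3^-1 + (6 * p%:R ^+ 2)^-1) ^+ d * N%:R ^+ 2 + 2^-1 ^+ d * (d.-1 ^ 2 * N)%:R.
Proof.
move=> dN; have [zeta zP] := closed_prim_root R[i] M0.
rewrite -lecR.
have := sum_prod_kern M0 zP (prime_gt0 p_pr) q0 erefl (y := fun (n : 'I_N) (i : 'I_d) => y n i)
  (fun k => expsum (k := fun i => k i) dN zP).
set lhs := \sum_n _; have -> : lhs = K%:C.
  rewrite /lhs /K rmorph_sum; apply: eq_bigr => n _.
  rewrite rmorph_sum; apply: eq_bigr => m _.
  by rewrite rmorph_prod; apply: eq_bigr => i _; rewrite kern_kpoly.
by rewrite !(rmorphD, rmorphM, rmorphXn, fmorphV, rmorph_nat) /=.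
Qed.

Lemma disc_le : K / N%:R ^+ 2 - 3^-1 ^+ d <= d%:R ^+ 2 / (2 ^+ d * N%:R).
Proof.
have Np0 : 0 < N%:R :> R by rewrite ltr0n.
have Nn0 : N%:R != 0 :> R by rewrite gt_eqF.
have c2 : 0 < 2^-1 ^+ d :> R by rewrite exprn_gt0 // invr_gt0.
have -> : d%:R ^+ 2 / (2 ^+ d * N%:R) = d%:R ^+ 2 * (2^-1 ^+ d / N%:R) :> R.
  by rewrite exprVn -invfM.
case: (leqP N (d ^ 2)) => dN.
  have h1 : K / N%:R ^+ 2 <= 2^-1 ^+ d.
    by rewrite ler_pdivrMr ?exprn_gt0 // mulrC K_trivial.
  have h2 : 2^-1 ^+ d <= d%:R ^+ 2 * (2^-1 ^+ d / N%:R) :> R.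
    rewrite mulrCA; apply: ler_peMr; first exact: ltW.
    by rewrite ler_pdivlMr // mul1r -natrX ler_nat.
  have h3 : 0 <= 3^-1 ^+ d :> R by rewrite exprn_ge0 // invr_ge0.
  by lra.
have p0 : 0 < p%:R :> R by rewrite ltr0n prime_gt0.
have h1 : K / N%:R ^+ 2 <= (3^-1 + (6 * p%:R ^+ 2)^-1) ^+ d
    + 2^-1 ^+ d * (d.-1)%:R ^+ 2 / N%:R.
  rewrite ler_pdivrMr ?exprn_gt0 //; apply: le_trans (K_fourier dN) _.
  rewrite le_eqVlt; apply/orP; left; apply/eqP.
  by rewrite natrM natrX; field.
have p2 : 4 <= p%:R ^+ 2 :> R.
  by rewrite -natrX ler_nat (leq_exp2r 2 p (e := 2)) // prime_gt1.
have e0 : 0 <= (6 * p%:R ^+ 2)^-1 :> R by rewrite invr_ge0 mulr_ge0 // exprn_ge0 // ltW.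
have h2 : (3^-1 + (6 * p%:R ^+ 2)^-1) ^+ d - 3^-1 ^+ d <=
    2 * d%:R * (6 * p%:R ^+ 2)^-1 * 2^-1 ^+ d :> R.
  have := @subX_le (3^-1 + (6 * p%:R ^+ 2)^-1) 3^-1 d.
  rewrite addrAC subrr add0r; apply; rewrite ?invr_ge0 ?lerDl //.
  (* This keeps the larger base below 1/3 + 1/6 = 1/2, as [subX_le] demands. *)
  have : (6 * p%:R ^+ 2)^-1 <= 6^-1 :> R.
    by rewrite lef_pV2 ?posrE ?mulr_gt0 ?exprn_gt0 //; lra.
  by lra.
have h3 : (6 * p%:R ^+ 2)^-1 <= 6^-1 / N%:R :> R.
  rewrite -invfM lef_pV2 ?posrE ?mulr_gt0 ?exprn_gt0 //.
  by rewrite ler_pM2l // -natrX ler_nat.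
have h4 : 2 * d%:R * (6 * p%:R ^+ 2)^-1 * 2^-1 ^+ d <=
    2 * d%:R * (6^-1 / N%:R) * 2^-1 ^+ d :> R.
  by rewrite ler_pM2r // ler_wpM2l // mulr_ge0.
(* With 2^-d / N factored out, what remains is d/3 + (d-1)^2 <= d^2, where d = 0 is separate because
   of the truncated predecessor. *)
suff h5 : 2 * d%:R * (6^-1 / N%:R) * 2^-1 ^+ d + 2^-1 ^+ d * (d.-1)%:R ^+ 2 / N%:R
    <= d%:R ^+ 2 * (2^-1 ^+ d / N%:R) :> R by lra.
have cN : 0 < 2^-1 ^+ d / N%:R :> R by rewrite divr_gt0.
have -> : 2 * d%:R * (6^-1 / N%:R) * 2^-1 ^+ d + 2^-1 ^+ d * (d.-1)%:R ^+ 2 / N%:R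
   = (d%:R / 3 + (d.-1)%:R ^+ 2) * (2^-1 ^+ d / N%:R) :> R by field.
rewrite ler_pM2r //; case: (d) => [|d']; first by rewrite /=; lra.
rewrite /= -natr1; have : 0 <= d'%:R :> R by [].
by nra.
Qed.

Lemma L2per_bound (X' : nat -> nat -> R) :
    (forall n i, X' n i = Defs.frac ((y n i)%:R / M%:R)) ->
  (L2per_sq d N X' < +oo)%E /\
  Num.sqrt (fine (L2per_sq d N X')) <= d%:R / Num.sqrt (2 ^+ d) / Num.sqrt N%:R.
Proof.
move=> X'E.
have -> : X' = X by apply/funext => n; apply/funext => i; rewrite X'E.
rewrite (L2per_sqE d N0) => [|n i]; last exact: frac_div01.
split; first exact: ltry.
rewrite /= -/K; apply: le_trans (ler_wsqrtr disc_le) _.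
rewrite -sqrtrV ?exprn_ge0 // -sqrtrV // -{2}[d%:R](ger0_norm (ler0n R d)) -sqrtr_sqr.
rewrite -!sqrtrM ?mulr_ge0 ?invr_ge0 ?exprn_ge0 // ?sqr_ge0 //.
by rewrite invfM mulrA.
Qed.

End Bound.

End Assembly.

Theorem theorem1 (R : realType) (p d : nat) (hp : prime p) :
  let bound (N : nat) : R :=
    d%:R / Num.sqrt (2 ^+ d) / Num.sqrt N%:R in
  [/\ (L2per_sq d p (@PKor R p) < +oo)%E /\
        Num.sqrt (fine (L2per_sq d p (@PKor R p))) <= bound p,
      (L2per_sq d (p ^ 2) (@QKor R p) < +oo)%E /\
        Num.sqrt (fine (L2per_sq d (p ^ 2) (@QKor R p))) <= bound (p ^ 2)%N
    & (L2per_sq d (p ^ 2) (@RKor R p) < +oo)%E /\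
        Num.sqrt (fine (L2per_sq d (p ^ 2) (@RKor R p))) <= bound (p ^ 2)%N].
Proof.
move=> bound; have p0 := prime_gt0 hp.
have sq_lt e : (d ^ 2 < p ^ e)%N -> (e <= 2)%N -> (d < p)%N.
  move=> lt le; rewrite -(@ltn_exp2r _ _ 2) //; apply: leq_trans lt _.
  by rewrite leq_exp2l // prime_gt1.
split.
- apply: (@L2per_bound R p 1 d p (fun n i => n ^ i.+1)%N) => //.
  + by rewrite -mulnn leq_pmulr.
  + move=> zeta k dN; rewrite muln1 => zP ex.
    apply: (expsum_P hp (@complex_arch R)) => //.
    by apply: (sq_lt 1%N); rewrite ?expn1.
  + by move=> n i; rewrite /PKor muln1.
- apply: (@L2per_bound R p p d (p ^ 2) (fun n i => n ^ i.+1)%N) => //.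
  + by rewrite expn_gt0 p0.
  + move=> zeta k dN zP ex; rewrite -mulnn.
    by apply: (expsum_Q hp) => //; apply: (sq_lt 2%N).
- apply: (@L2per_bound R p 1 d (p ^ 2) (fun n i => (n %/ p) ^ i * (n %% p))%N) => //.
  + by rewrite expn_gt0 p0.
  + by move=> zeta k dN; rewrite muln1 => zP ex; rewrite -mulnn; exact: (expsum_R hp).
  + by move=> n i; rewrite /RKor muln1.
Qed.
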